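(* Let $M\subset\mathbb{R}^n$ be an embedded smooth compact manifold without boundary with reach $\rho$. Let $P$ be an $\varepsilon$-sample of $(M,d_E)$, and let $Q\subseteq P$ be a $\delta$-sample of $(P,d_G)$, where $d_G$ is the graph distance of $G^{\alpha}(P)$. If $4\varepsilon\le\alpha\le\frac13\sqrt{\frac35}\,\rho$ and $4\varepsilon\le\delta\le\frac13\sqrt{\frac35}\,\rho$, then the map $$h_*:\mathsf{H}_1(\mathcal{R}^{\alpha}(P))\to\mathsf{H}_1(\mathcal{G}^{\alpha}(P,Q,d_G))$$ is an isomorphism, where $h:\mathcal{R}^{\alpha}(P)\to\mathcal{G}^{\alpha}(P,Q,d_G)$ is the simplicial map induced by the nearest point map $\nu_{d_G}:P\to Q$.
   Context: $d_E$ is the Euclidean distance. The reach of $M$ is the minimum distance from $M$ to its medial axis. A finite set $P\subseteq X$ is an $\varepsilon$-sample of a metric space $(X,d)$ if every $x\in X$ has a point $p\in P$ with $d(x,p)\le\varepsilon$. $G^{\alpha}(P)$ is the graph on $P$ joining $p_1,p_2$ iff $\|p_1-p_2\|\le\alpha$; $d_G=d_{G^{\alpha}(P)}$ is the shortest-path distance in this graph with Euclidean lengths as edge weights. The Rips complex $\mathcal{R}^{\alpha}(P)$ is the simplicial complex whose simplices are the nonempty subsets of $P$ with all pairwise Euclidean distances at most $\alpha$. Given a distance $d$ on $P$ and $Q\subseteq P$, the nearest point map $\nu_d:P\to Q$ sends each $p$ to a point of $Q$ minimizing $d(p,\cdot)$ over $Q$. The graph induced complex $\mathcal{G}^{\alpha}(P,Q,d)$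 is the simplicial complex with vertex set $Q$ in which a set $\{q_1,\dots,q_{k+1}\}$ of $k+1$ distinct points of $Q$ is a $k$-simplex iff there is a $(k+1)$-clique $\{p_1,\dots,p_{k+1}\}$ in $G^{\alpha}(P)$ with $\nu_d(p_i)=q_i$ for all $i$. The map $h$ sends a simplex $\{p_1,\dots,p_{k+1}\}$ of $\mathcal{R}^{\alpha}(P)$ to the simplex with vertex set $\{\nu_d(p_1),\dots,\nu_d(p_{k+1})\}$. Homology is simplicial homology with coefficients in $\mathbb{Z}_2$.
   Formalization: Ties in the nearest point map are broken by a fixed (arbitrary) priority order on Q; if ties may be broken independently at each point of P, changing the image of one tied point can add an edge lying in no triangle, so the claim fails. *)

(* Defs.v *)
From HB Require Import structures.
From mathcomp Require Import all_boot all_order all_algebra finmap.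
From mathcomp Require Import generic_quotient ring_quotient.
From mathcomp Require Import all_classical all_reals all_analysis.

Set Implicit Arguments.
Unset Strict Implicit.
Unset Printing Implicit Defensive.

Import Order.TTheory GRing.Theory Num.Theory.
Import numFieldNormedType.Exports.

Local Open Scope classical_set_scope.
Local Open Scope ring_scope.
Local Open Scope fset_scope.

Section Homology.
Variable T : choiceType.
Implicit Types K L : {fset {fset T}}.

Definition simplicial_complex K :=
  fset0 \notin K /\
  forall s t : {fset T}, s \in K -> t `<=` s -> t != fset0 -> t \in K.

Definition simplices K (k : nat) : {fset {fset T}} :=
  [fset s in K | #|` s| == k.+1].

Definition chain K k := {ffun simplices K k -> ('F_2)^o}.
HB.instance Definition _ K k := Vector.on (chain K k).

(* Orientations play no role modulo 2, so the coefficient of the boundary at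
   [t] is the sum of the coefficients at the simplices having [t] as a facet. *)
Definition bd_fun K k (c : chain K k.+1) : chain K k :=
  [ffun t : simplices K k =>
     \sum_(s : simplices K k.+1 | val t `<=` val s) c s].

Definition push_fun (f : T -> T) K L k (c : chain K k) : chain L k :=
  [ffun t : simplices L k =>
     \sum_(s : simplices K k | f @` val s == val t) c s].

Fact bd_fun_linear K k : linear (@bd_fun K k).
Proof.
move=> a c d; apply/ffunP => t; rewrite !ffunE scaler_sumr -big_split /=.
by apply: eq_bigr => s _; rewrite !ffunE.
Qed.

Fact push_fun_linear f K L k : linear (@push_fun f K L k).
Proof.
move=> a c d; apply/ffunP => t; rewrite !ffunE scaler_sumr -big_split /=.
by apply: eq_bigr => s _; rewrite !ffunE.
Qed.

HB.instance Definition _ K k := GRing.isLinear.Build 'F_2 (chain K k.+1)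
  (chain K k) _ (@bd_fun K k) (@bd_fun_linear K k).
HB.instance Definition _ f K L k := GRing.isLinear.Build 'F_2 (chain K k)
  (chain L k) _ (@push_fun f K L k) (@push_fun_linear f K L k).

Definition bd K k : 'Hom(chain K k.+1, chain K k) := linfun (@bd_fun K k).

(* Simplices on which [f] is not injective are sent to 0, because [t] below
   has as many vertices as [s]. *)
Definition push f K L k : 'Hom(chain K k, chain L k) :=
  linfun (@push_fun f K L k).

Definition cycles K k : {vspace chain K k} :=
  match k with 0 => fullv | j.+1 => lker (bd K j) end.

Definition boundaries K k : {vspace chain K k} := limg (bd K k).

Definition bounding K k : {pred subvs_of (cycles K k)} :=
  [pred z | vsval z \in boundaries K k].
Arguments bounding K k : clear implicits.

Fact bounding_closed K k : zmod_closed (bounding K k).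
Proof.
by split=> [|x y]; rewrite !inE /= ?linear0 ?linearB ?mem0v //; exact: rpredB.
Qed.

HB.instance Definition _ K k :=
  GRing.isZmodClosed.Build _ (bounding K k) (@bounding_closed K k).

Definition homology K k := Quotient.quot (bounding K k).

(* [homology_map] is the map induced on homology by a vertex map [f] that
   defines a simplicial map from [K] to [L]: see [homology_map_pi]. *)
Definition homology_map f K L k (x : homology K k) : homology L k :=
  \pi_(Quotient.quot (bounding L k))%qT
    (vsproj (cycles L k) (push f K L k (vsval (repr x)))).

Definition simplicial_map (f : T -> T) K L :=
  forall s : {fset T}, s \in K -> f @` s \in L.

Lemma simplicesP K k (s : simplices K k) :
  val s \in K /\ #|` val s| = k.+1.
Proof. by have := valP s; rewrite !inE => /andP[-> /eqP ->]. Qed.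

Lemma simplices_in K k (s : {fset T}) :
  s \in K -> #|` s| = k.+1 -> s \in simplices K k.
Proof. by move=> sK sk; rewrite !inE sK sk eqxx. Qed.


Lemma boundary_count (f : T -> T) K L k (s : simplices K k.+1)
    (t : simplices L k) :
  simplicial_complex K -> simplicial_map f K L ->
  odd #|[pred u : simplices L k.+1 | (val t `<=` val u) && (f @` val s == val u)]|
  = odd #|[pred r : simplices K k | (f @` val r == val t) && (val r `<=` val s)]|.
Proof.
set A := [pred u | _]; set B := [pred r | _].
move=> [_ Kdown] fKL; have [sK ssz] := simplicesP s; have [_ tsz] := simplicesP t.
have faceP x : x \in val s -> val s `\ x \in simplices K k.
  move=> xs; have xsz : #|` val s `\ x| = k.+1.
    by move: (cardfsD1 x (val s)); rewrite xs ssz add1n => -[].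
  apply: simplices_in => //; apply: Kdown sK (fsubD1set _ _) _.
  by rewrite -cardfs_gt0 xsz.
have faceE (r : simplices K k) : val r `<=` val s ->
    exists2 x, x \in val s & val r = val s `\ x.
  move=> rs; have [_ rsz] := simplicesP r.
  have /cardfs1P[x dx] : #|` val s `\` val r| == 1%N.
    by rewrite (cardfsDS rs) ssz rsz subSnn.
  have : x \in val s `\` val r by rewrite dx fset11.
  rewrite inE => /andP[_ xs]; exists x => //.
  by rewrite -dx fsetDK.
have fsD x : f @` (val s `\ x) `<=` f @` val s.
  by apply: subset_imfset => y /=; rewrite !inE => /andP[].
have [tfs|ntfs] := boolP (val t `<=` f @` val s); last first.
  rewrite (@fintype.eq_card0 _ A) => [|u]; last first.
    rewrite /A !inE; apply/negbTE.
    by apply: contra ntfs => /andP[tu /eqP ->].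
  rewrite (@fintype.eq_card0 _ B) // => r; rewrite /B !inE; apply/negbTE.
  apply: contra ntfs => /andP[/eqP <- rs]; apply: subset_imfset => y.
  exact: (fsubsetP rs).
have fs_le : (#|` f @` val s| <= k.+2)%N by apply: leq_trans (leq_imfset_card _ _ _) _; rewrite ssz.
have fs_ge : (k.+1 <= #|` f @` val s|)%N by move: (fsubset_leq_card tfs); rewrite tsz.
have [fs_sz|fs_sz] := eqVneq #|` f @` val s| k.+2.
- have finj : {in val s &, injective f}.
    by apply/card_in_imfsetP; rewrite fs_sz ssz.
  have uL := simplices_in (fKL _ sK) fs_sz.
  rewrite (@fintype.eq_card1 _ (FSetSub uL) A) => [|u]; last first.
    rewrite /A !inE -val_eqE /= eq_sym; case: eqP => [->|]; rewrite ?andbF //.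
    by rewrite tfs.
  have /cardfs1P[y dy] : #|` f @` val s `\` val t| == 1%N.
    by rewrite (cardfsDS tfs) fs_sz tsz subSnn.
  have : y \in f @` val s `\` val t by rewrite dy fset11.
  rewrite inE => /andP[ynt /imfsetP[x /= xs yx]].
  rewrite (@fintype.eq_card1 _ (FSetSub (faceP x xs)) B) // => r; rewrite /B !inE -val_eqE /=.
  apply/andP/eqP => [[/eqP rt rs]|->].
    have [z zs rz] := faceE r rs; rewrite rz; suff -> : z = x by [].
    apply: (finj) => //; rewrite -yx; apply/eqP; rewrite -in_fset1 -dy inE.
    rewrite in_imfset //= andbT -rt; apply/negP => /imfsetP[w /= wr zw].
    have ws := fsubsetP rs _ wr.
    by move: wr; rewrite rz !inE (finj _ _ zs ws zw) eqxx.
  split; last exact: fsubD1set.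
  rewrite -(fsetDK tfs) dy yx; apply/eqP/fsetP => w.
  apply/imfsetP/idP => [[v /=]|].
    rewrite !inE => /andP[vx vs] ->; rewrite in_imfset //= andbT.
    by apply: contra vx => /eqP /finj ->.
  rewrite !inE => /andP[wx /imfsetP[v /= vs wv]]; exists v => //.
  by rewrite !inE vs andbT; apply: contra wx => /eqP <-; rewrite wv.
have {fs_le fs_ge}fs_sz : #|` f @` val s| = k.+1.
  by apply/eqP; rewrite eqn_leq fs_ge andbT -ltnS ltn_neqAle fs_sz.
have {tfs}tfs : val t = f @` val s.
  by apply/eqP; rewrite eqEfcard tfs tsz fs_sz leqnn.
rewrite (@fintype.eq_card0 _ A) => [|u]; last first.
  rewrite /A !inE; apply/negP => /andP[_ /eqP fu].
  by have [_] := simplicesP u; rewrite -fu fs_sz => /eqP; rewrite eqn_leq ltnn andbF.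
have [x [x' [xs x's fxx' xx']]] : exists x x',
    [/\ x \in val s, x' \in val s, f x = f x' & x != x'].
  apply: contrapT => H; have : #|` f @` val s| == #|` val s|.
    apply/card_in_imfsetP => x x' xs x's fx; apply: contrapT => /eqP nx.
    by apply: H; exists x, x'.
  by rewrite fs_sz ssz => /eqP /esym /eqP; rewrite eqn_leq ltnn.
have fD y y' : y \in val s -> y' \in val s -> y != y' -> f y = f y' ->
    f @` (val s `\ y) = f @` val s.
  move=> ys y's yy' fyy'; apply/eqP; rewrite eqEfsubset fsD /=.
  apply/fsubsetP => _ /imfsetP[w /= ws ->]; apply/imfsetP => /=.
  have [->|wy] := eqVneq w y; first by exists y' => //; rewrite !inE eq_sym yy'.
  by exists w => //; rewrite !inE wy.
have injD : {in val s `\ x &, injective f}.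
  apply/card_in_imfsetP; rewrite (fD _ x') // fs_sz.
  by have [_ ->] := simplicesP (FSetSub (faceP x xs)).
have nface : (FSetSub (faceP x xs)) != (FSetSub (faceP x' x's)).
  rewrite -val_eqE /=; apply/eqP => /fsetP /(_ x).
  by rewrite !inE eqxx xx' xs.
rewrite (@fintype.eq_card _ B (pred2 (FSetSub (faceP x xs)) (FSetSub (faceP x' x's)))).
  by rewrite card2 nface.
move=> r; rewrite /B !inE -!val_eqE /= tfs; apply/andP/orP; last first.
  case=> /eqP ->; split; rewrite ?fsubD1set //; apply/eqP.
    exact: (fD _ x').
  by apply: (fD _ x); rewrite // eq_sym.
case=> /eqP rfs /faceE[z zs rz].
have [zx|zx] := eqVneq z x; first by left; rewrite rz zx.
have [zx'|zx'] := eqVneq z x'; first by right; rewrite rz zx'.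
have : f z \in f @` val r by rewrite rfs in_imfset.
rewrite rz => /imfsetP[w /=]; rewrite !inE => /andP[wz ws] fzw.
have zsx : z \in val s `\ x by rewrite !inE zx.
have [wx|wx] := eqVneq w x.
  have x'sx : x' \in val s `\ x by rewrite !inE eq_sym xx'.
  by case/eqP: zx'; apply: (injD); rewrite // fzw wx.
have wsx : w \in val s `\ x by rewrite !inE wx.
by case/eqP: wz; apply: (injD).
Qed.

Lemma push_bd (f : T -> T) K L k (c : chain K k.+1) :
  simplicial_complex K -> simplicial_map f K L ->
  bd L k (push f K L k.+1 c) = push f K L k (bd K k c).
Proof.
move=> cK fKL; rewrite !lfunE /=; apply/ffunP => t; rewrite !ffunE.
under eq_bigr do rewrite ffunE; under [RHS]eq_bigr do rewrite ffunE.
rewrite (exchange_big_dep predT) //= [RHS](exchange_big_dep predT) //=.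
apply: eq_bigr => s _; rewrite !sumr_const.
have c2 : c s *+ 2 = 0 by apply: val_inj; case: (c s) => -[|[|[]]].
have parity n : c s *+ n = c s *+ odd n.
  by rewrite -[in LHS](odd_double_half n) mulrnDr -mul2n mulrnA c2 mul0rn addr0.
by rewrite parity (boundary_count s t cK fKL) -parity.
Qed.

Lemma push_cycles (f : T -> T) K L k (c : chain K k) :
  simplicial_complex K -> simplicial_map f K L ->
  c \in cycles K k -> push f K L k c \in cycles L k.
Proof.
case: k c => [|k] c cK fKL; first by move=> _; exact: memvf.
by rewrite !memv_ker push_bd // => /eqP ->; rewrite linear0 eqxx.
Qed.

Lemma homology_map_pi (f : T -> T) K L k (z : subvs_of (cycles K k)) :
  simplicial_complex K -> simplicial_map f K L ->
  homology_map f L (\pi_(Quotient.quot (bounding K k))%qT z) =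
  \pi_(Quotient.quot (bounding L k))%qT
    (vsproj (cycles L k) (push f K L k (vsval z))).
Proof.
move=> cK fKL; apply/eqP; rewrite /homology_map -Quotient.idealrBE.
set y := repr _; have : y - z \in bounding K k.
  by rewrite Quotient.idealrBE reprK.
rewrite !inE linearB /= => /memv_imgP[d _ yz].
rewrite !vsprojK ?push_cycles ?subvsP // -linearB yz.
by rewrite -[X in X \in _]/(push f K L k (bd K k d)) -push_bd // memv_img ?memvf.
Qed.
End Homology.

Arguments homology_map {T} f K L k x.

Definition zmod_isomorphism (U V : zmodType) (f : U -> V) :=
  zmod_morphism f /\ bijective f.

Section Samples.
Variables (R : realType) (T : choiceType) (d : T -> T -> \bar R).

Definition is_sample (X : set T) (eps : R) (S : {fset T}) :=
  ([set` S] `<=` X)%classic /\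
  forall x, X x -> exists2 p, p \in S & (d x p <= eps%:E)%E.

(* A point may have several nearest points.  Ties are broken by a fixed rule:
   [nu p] is the nearest point of least priority, where [prio] is injective on
   [Q].  If the nearest point is unique, the last clause holds trivially.  With
   ties broken independently at each point of [P], the fibers of [nu] need not
   be connected along shortest paths, and the induced map on first homology
   need not be surjective. *)
Definition nearest_point_map (P Q : {fset T}) (prio : T -> nat) (nu : T -> T) :=
  forall p, p \in P ->
    [/\ nu p \in Q,
        forall q, q \in Q -> (d p (nu p) <= d p q)%E &
        forall q, q \in Q -> d p q = d p (nu p) -> (prio (nu p) <= prio q)%N].
End Samples.

Section Geometry.
Variables (R : realType) (n : nat).
Local Notation E := 'rV[R]_n.
Implicit Types (M : set E) (P Q s t : {fset E}) (alpha : R).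

(* The norm of the library on ['rV[R]_n] is the sup norm; it has the same
   topology and the same derivatives as the Euclidean norm. *)
Definition eucl_dist (x y : E) : R :=
  Num.sqrt (\sum_(i < n) (x ord0 i - y ord0 i) ^+ 2).

(* All iterated directional derivatives up to order k exist and are
   continuous on the (open) set U. *)
Fixpoint C_on (k : nat) (U : set E) (f : E -> E) : Prop :=
  match k with
  | 0 => forall x, U x -> {for x, continuous f}
  | j.+1 => (forall x v, U x -> derivable f x v) /\
            (forall v, C_on j U (fun x => 'D_v f x))
  end.

Definition smooth_on (U : set E) (f : E -> E) := forall k, C_on k U f.

Definition diffeomorphism (U V : set E) (phi psi : E -> E) :=
  [/\ smooth_on U phi, smooth_on V psi,
      forall x, U x -> V (phi x) /\ psi (phi x) = x &
      forall y, V y -> U (psi y) /\ phi (psi y) = y].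

(* m-dimensional, without boundary: locally M is a flat coordinate m-plane. *)
Definition embedded_smooth_manifold (m : nat) M :=
  (m <= n)%N /\
  forall x, M x -> exists (U V : set E) (phi psi : E -> E),
    [/\ open U, U x, open V, diffeomorphism U V phi psi &
        forall y, U y ->
          (M y <-> forall j : 'I_n, (m <= j)%N -> phi y ord0 j = 0)].

Definition nearest_in M (x y : E) :=
  M y /\ forall z, M z -> eucl_dist x y <= eucl_dist x z.

Definition medial_axis M : set E :=
  closure [set x | exists y z, [/\ y <> z, nearest_in M x y & nearest_in M x z]].

(* [+oo] if the medial axis is empty, e.g. if M is a single point *)
Definition reach M : \bar R :=
  ereal_inf [set (eucl_dist x y)%:E | x in M & y in medial_axis M]%classic.

Definition graph_edge alpha (p q : E) : bool := (p != q) && (eucl_dist p q <= alpha).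

Definition graph_walk alpha P (p q : E) (w : seq E) : Prop :=
  [/\ path (graph_edge alpha) p w, {subset p :: w <= P} & last p w = q].

Definition walk_length (p : E) (w : seq E) : R :=
  \sum_(e <- zip (p :: w) w) eucl_dist e.1 e.2.

(* [+oo] if p and q lie in different components of the graph *)
Definition graph_dist alpha P (p q : E) : \bar R :=
  ereal_inf [set (walk_length p w)%:E | w in graph_walk alpha P p q]%classic.

Definition rips_complex alpha P : {fset {fset E}} :=
  [fset s in fpowerset P |
    (s != fset0) &&
    [forall p : s, forall q : s, eucl_dist (val p) (val q) <= alpha]].

Definition clique alpha P s : bool :=
  (s `<=` P) &&
  [forall p : s, forall q : s, (p != q) ==> graph_edge alpha (val p) (val q)].

(* Requiring [nu] to map the clique onto [t], with as many points, amounts to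
   a numbering p_i, q_i of both sets with nu p_i = q_i. *)
Definition graph_induced_complex alpha P Q (nu : E -> E) : {fset {fset E}} :=
  [fset t in fpowerset Q |
    (t != fset0) &&
    [exists s : fpowerset P,
      [&& clique alpha P (val s), #|` val s| == #|` t| & nu @` val s == t]]].

Lemma ripsP alpha P s : reflect
  [/\ s `<=` P, s != fset0 & {in s &, forall p q, eucl_dist p q <= alpha}]
  (s \in rips_complex alpha P).
Proof.
rewrite !inE /= fpowersetE; apply: (iffP and3P) => [[sP s0 /forallP H]|[sP s0 H]].
  by split=> // p q ps qs; exact: (forallP (H [` ps]) [` qs]).
by split=> //; apply/forallP => p; apply/forallP => q; apply: H; exact: valP.
Qed.

Lemma cliqueE alpha P s : s \in rips_complex alpha P -> clique alpha P s.
Proof.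
move=> /ripsP[sP s0 H]; rewrite /clique sP; apply/forallP => p.
apply/forallP => q; apply/implyP => pq; rewrite /graph_edge.
by rewrite H ?andbT //; exact: valP.
Qed.

Lemma clique_sub alpha P s t : t `<=` s -> clique alpha P s -> clique alpha P t.
Proof.
move=> ts /andP[sP /forallP H]; rewrite /clique (fsubset_trans ts sP) /=.
apply/forallP => p; apply/forallP => q; apply/implyP => pq.
have ps := fsubsetP ts _ (valP p); have qs := fsubsetP ts _ (valP q).
by have /implyP := forallP (H [` ps]) [` qs]; apply; rewrite -val_eqE.
Qed.

Lemma gicP alpha P Q (nu : E -> E) t : reflect
  [/\ t `<=` Q, t != fset0 &
      exists2 s, clique alpha P s & t `<=` nu @` s]
  (t \in graph_induced_complex alpha P Q nu).
Proof.
rewrite !inE /= fpowersetE; apply: (iffP and3P) => [[tQ t0 /existsP[s]]|].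
  case/and3P=> cs _ /eqP st; split=> //; exists (val s) => //.
  by rewrite -st fsubset_refl.
case=> tQ t0 [s cs tns]; split=> //.
have inv y : exists x, y \in t -> x \in s /\ nu x = y.
  have [yt|] := boolP (y \in t); last by exists y.
  by have /imfsetP[x /= xs ->] := fsubsetP tns _ yt; exists x.
have [g gP] := choice inv; pose r := g @` t.
have rs : r `<=` s.
  by apply/fsubsetP => _ /imfsetP[y /= yt ->]; case: (gP y yt).
have rP : r \in fpowerset P.
  by rewrite fpowersetE (fsubset_trans rs) //; case/andP: cs.
apply/existsP; exists [` rP] => /=; rewrite (clique_sub rs cs) /=.
apply/andP; split.
  apply/card_in_imfsetP => x y xt yt gxy.
  by have [_ <-] := gP x xt; have [_ <-] := gP y yt; rewrite gxy.
apply/eqP/fsetP => y; apply/imfsetP/idP => /= [[_ /imfsetP[z /= zt ->] ->]|yt].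
  by have [_ ->] := gP z zt.
by exists (g y); [rewrite in_imfset | have [_ ->] := gP y yt].
Qed.

Lemma rips_complexP alpha P : simplicial_complex (rips_complex alpha P).
Proof.
split=> [|s t /ripsP[sP s0 H] ts t0]; first by apply/ripsP => -[_]; rewrite eqxx.
apply/ripsP; split=> // [|p q pt qt]; first exact: fsubset_trans ts sP.
by apply: H; exact: (fsubsetP ts).
Qed.

Lemma graph_induced_complexP alpha P Q (nu : E -> E) :
  simplicial_complex (graph_induced_complex alpha P Q nu).
Proof.
split=> [|s t /gicP[sQ s0 [r cr sr]] ts t0].
  by apply/gicP => -[_]; rewrite eqxx.
apply/gicP; split=> //; first exact: fsubset_trans ts sQ.
by exists r => //; exact: fsubset_trans ts sr.
Qed.

Lemma simplicial_map_gic alpha P Q (nu : E -> E) :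
  {in P, forall p, nu p \in Q} ->
  simplicial_map nu (rips_complex alpha P) (graph_induced_complex alpha P Q nu).
Proof.
move=> nuQ s sK; have /ripsP[sP s0 _] := sK; apply/gicP; split.
- apply/fsubsetP => _ /imfsetP[p /= ps ->]; apply: nuQ; exact: (fsubsetP sP).
- have [p ps] := fset0Pn _ s0; apply/fset0Pn; exists (nu p).
  by rewrite in_imfset.
- by exists s; [exact: cliqueE | exact: fsubset_refl].
Qed.
End Geometry.

(* Main.v *)
(* The nearest point map pi is defined on the tube of radius reach M around M.
   A growth argument for the distance to M gives Federer's tangent balls, and
   with them Lipschitz continuity of pi on smaller tubes and a bound on the
   distance from the points of a short chord to M.  Composing pi with a nearest
   sample turns the affine cone over an edge {u, v} of the Rips complex, with
   apex c within 3 max(alpha, delta) of u and v, into a fine grid of simplices,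
   so every loop of graph length at most 2 alpha + 4 delta bounds in the Rips
   complex.  The fibers of nu contain the shortest paths to their centers,
   whence edges of the graph induced complex lift to the Rips complex through
   paths that nu contracts.  Two lifts differ by loops of length at most
   2 alpha + 4 delta, so lifting is inverse to nu on first homology. *)

From HB Require Import structures.
Require Import Defs.
From mathcomp Require Import all_boot all_order all_algebra finmap.
From mathcomp Require Import generic_quotient ring_quotient.
From mathcomp Require Import all_classical all_reals all_analysis.
From mathcomp Require Import ring lra.

Set Implicit Arguments.
Unset Strict Implicit.
Unset Printing Implicit Defensive.

Import Order.TTheory GRing.Theory Num.Theory.
Import numFieldNormedType.Exports.
Local Open Scope classical_set_scope.
Local Open Scope fset_scope.
Local Open Scope ring_scope.

(** * Chains modulo 2 *)

Section Chains.
Variable T : choiceType.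
Implicit Types (K L : {fset {fset T}}) (A : {fset T}).

(** Zero when [A] is not a [k]-simplex of [K]; this convention makes degenerate simplices harmless
    below. *)
Definition simplex_chain K k A : chain K k := [ffun t => (val t == A)%:R].

Lemma addcc K k (c : chain K k) : c + c = 0.
Proof. by apply/ffunP => t; rewrite !ffunE; apply: val_inj; case: (c t) => -[|[|[]]]. Qed.

Lemma chain_sum_simplex K k (c : chain K k) : c = \sum_s c s *: simplex_chain K k (val s).
Proof.
apply/ffunP => t; rewrite sum_ffunE (bigD1 t) //= big1 ?addr0 => [|s].
  by rewrite !ffunE eqxx [_ *: _]mulr1.
by rewrite eq_sym !ffunE val_eqE => /negPf ->; rewrite scaler0.
Qed.

Lemma lfun_simplex_mem K k (V : vectType 'F_2) (W : {vspace V})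
    (phi : 'Hom(chain K k, V)) :
  (forall A, A \in simplices K k -> phi (simplex_chain K k A) \in W) ->
  forall c, phi c \in W.
Proof.
move=> phiW c; rewrite (chain_sum_simplex c) linear_sum memv_suml // => s _.
by rewrite linearZ memvZ //; apply: phiW; exact: valP.
Qed.

Lemma eq_lfun_simplex K k (V : vectType 'F_2) (phi psi : 'Hom(chain K k, V)) :
  (forall A, A \in simplices K k -> phi (simplex_chain K k A) = psi (simplex_chain K k A)) ->
  phi =1 psi.
Proof.
move=> e c; apply/eqP; rewrite -subr_eq0 -memv0 -opp_lfunE -add_lfunE.
by apply: lfun_simplex_mem => A AK; rewrite add_lfunE opp_lfunE e // subrr mem0v.
Qed.

Section Extension.
Variables (K : {fset {fset T}}) (k : nat) (V : vectType 'F_2) (g : {fset T} -> V).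

Definition lin_ext_fun (c : chain K k) : V := \sum_s c s *: g (val s).

Fact lin_ext_fun_linear : linear lin_ext_fun.
Proof.
move=> a c d; rewrite /lin_ext_fun scaler_sumr -big_split /=.
by apply: eq_bigr => s _; rewrite !ffunE scalerDl scalerA.
Qed.

HB.instance Definition _ := GRing.isLinear.Build 'F_2 (chain K k) V _ lin_ext_fun
  lin_ext_fun_linear.

Definition lin_ext : 'Hom(chain K k, V) := linfun lin_ext_fun.

Lemma lin_ext_simplex A : A \in simplices K k -> lin_ext (simplex_chain K k A) = g A.
Proof.
move=> AK; rewrite lfunE /= /lin_ext_fun (bigD1 [` AK]) //= big1 ?addr0 => [|s].
  by rewrite ffunE eqxx scale1r.
by rewrite ffunE -val_eqE => /negPf ->; rewrite scale0r.
Qed.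
End Extension.

Lemma bd_simplex K k A : A \in simplices K k.+1 ->
  bd K k (simplex_chain K k.+1 A) = \sum_(x <- A) simplex_chain K k (A `\ x).
Proof.
move=> AK; rewrite lfunE /=; apply/ffunP => t; rewrite ffunE sum_ffunE.
have [_ tsz] := simplicesP t; have [_ Asz] := simplicesP [` AK].
rewrite (_ : \sum_(s : simplices K k.+1 | _) _ = (val t `<=` A)%:R); last first.
  rewrite big_mkcond (bigD1 [` AK]) //= ffunE eqxx big1 ?addr0 => [|s].
    by case: ifP.
  by rewrite ffunE -val_eqE => /negPf ->; rewrite if_same.
have [tA|ntA] := boolP (val t `<=` A); last first.
  rewrite big1_seq // => x _; rewrite ffunE.
  by case: eqP ntA => // -> /negP []; exact: fsubD1set.
have /cardfs1P[x dx] : #|` A `\` val t| == 1%N.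
  by rewrite (cardfsDS tA) Asz tsz subSnn.
have : x \in A `\` val t by rewrite dx fset11.
have tE : val t = A `\ x by rewrite -dx fsetDK.
rewrite inE => /andP[_ xA]; rewrite (big_fsetD1 x) //= !ffunE tE eqxx.
rewrite big1_seq ?addr0 // => y; rewrite !inE => /andP[_ /andP[yx yA]].
rewrite ffunE tE; case: eqP => // /fsetP /(_ y).
by rewrite !inE eqxx yx yA.
Qed.

(** If [f] collapses [A], both sides are 0: the image then has fewer than [k.+1] vertices. *)
Lemma push_simplex (f : T -> T) K L k A :
  simplicial_map f K L -> A \in K -> #|` A| = k.+1 ->
  push f K L k (simplex_chain K k A) = simplex_chain L k (f @` A).
Proof.
move=> fKL AK Ak; rewrite lfunE /=; apply/ffunP => t; rewrite !ffunE.
have AS := simplices_in AK Ak.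
rewrite big_mkcond (bigD1 [` AS]) //= ffunE eqxx big1 ?addr0 => [|s].
  by rewrite eq_sym; case: eqP.
by rewrite ffunE -val_eqE => /negPf ->; rewrite if_same.
Qed.

Lemma simplex_chain_small K k A : #|` A| != k.+1 -> simplex_chain K k A = 0.
Proof.
move=> Ak; apply/ffunP => t; rewrite !ffunE; case: eqP => // tA.
by case: (simplicesP t) => _; rewrite tA => /eqP; rewrite (negPf Ak).
Qed.

Lemma fset2D1l (a b : T) : a != b -> [fset a; b] `\ a = [fset b].
Proof.
by move=> ab; rewrite fsetU1K // inE.
Qed.

Lemma fset2D1r (a b : T) : a != b -> [fset a; b] `\ b = [fset a].
Proof. by rewrite eq_sym fsetUC; exact: fset2D1l. Qed.

Lemma fset3E (a b c : T) : [fset a; b; c] = a |` [fset b; c].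
Proof. by rewrite -fsetUA. Qed.

Lemma fset3C (a b c : T) : [fset a; b; c] = [fset b; c; a].
Proof. by rewrite fset3E fsetUC. Qed.

Lemma fset3D1 (a b c : T) : a != b -> a != c ->
  [fset a; b; c] `\ a = [fset b; c].
Proof. by move=> ab ac; rewrite fset3E fsetU1K // !inE negb_or ab. Qed.

Lemma big_fset3 (V : nmodType) (F : T -> V) (a b c : T) :
  a != b -> a != c -> b != c ->
  \sum_(x <- [fset a; b; c]) F x = F a + (F b + F c).
Proof.
move=> ab ac bc; rewrite fset3E big_fsetU1 /= ?inE ?negb_or ?ab //.
by rewrite big_fsetU1 ?inE //= big_seq_fset1.
Qed.

(** * Edges, triangles and homologous chains *)

Definition vertex K a := simplex_chain K 0 [fset a].
(** The ends may coincide: [[fset a; a]] is a singleton, so the edge is then 0. Constant steps of a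
    path and collapsed edges need no separate case. *)
Definition edge K a b := simplex_chain K 1 [fset a; b].

Lemma edgeC K a b : edge K a b = edge K b a.
Proof. by rewrite /edge fsetUC. Qed.

Lemma edge_id K a : edge K a a = 0.
Proof. by rewrite /edge fsetUid simplex_chain_small // cardfs1. Qed.

Lemma bd_edge K a b : [fset a; b] \in K ->
  bd K 0 (edge K a b) = vertex K a + vertex K b.
Proof.
have [->|ab] := eqVneq a b; first by rewrite edge_id linear0 addcc.
move=> abK; rewrite bd_simplex; last by rewrite simplices_in // cardfs2 ab.
rewrite big_fsetU1 ?inE //= big_seq_fset1 addrC fset2D1l // fset2D1r //.
Qed.

Lemma push_edge (f : T -> T) K L a b : simplicial_map f K L ->
  [fset a; b] \in K -> push f K L 1 (edge K a b) = edge L (f a) (f b).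
Proof.
have [->|ab] := eqVneq a b; first by rewrite !edge_id linear0.
move=> fKL abK; rewrite push_simplex // ?cardfs2 ?ab //.
congr (simplex_chain _ _ _). by rewrite imfsetU !imfset_fset1.
Qed.

(** Holds for coinciding vertices too: the left side is then 0, and on the right one edge is
    degenerate while the other two cancel modulo 2. *)
Lemma bd_triangle K a b c : [fset a; b; c] \in K ->
  bd K 1 (simplex_chain K 2 [fset a; b; c]) = edge K a b + edge K b c + edge K a c.
Proof.
have ind2 A : (#|` A| < 3)%N -> simplex_chain K 2 A = 0.
  by move=> A2; rewrite simplex_chain_small // neq_ltn A2.
have [<-|ab] := eqVneq a b.
  by rewrite edge_id add0r addcc fsetUid ind2 ?linear0 // cardfs2; case: (_ != _).
have [<-|ac] := eqVneq a c.
  rewrite edge_id addr0 edgeC addcc fset3C fset3C fsetUid ind2 ?linear0 //.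
  by rewrite cardfs2; case: (_ != _).
have [<-|bc] := eqVneq b c.
  by rewrite edge_id addr0 addcc fset3C fsetUid ind2 ?linear0 // cardfs2; case: (_ != _).
move=> abcK; have Asz : #|` [fset a; b; c]| = 3%N.
  by rewrite fsetUC cardfsU1 cardfs2 ab !inE negb_or ![c == _]eq_sym ac bc.
rewrite bd_simplex ?simplices_in // big_fset3 // fset3D1 //.
rewrite [X in X `\ b]fset3C [X in X `\ c]fset3C [X in X `\ c]fset3C.
have [ba ca cb] : [/\ b != a, c != a & c != b] by rewrite ![_ == a]eq_sym [c == b]eq_sym.
rewrite (fset3D1 bc ba) (fset3D1 ca cb).
rewrite -/(edge K b c) -/(edge K c a) -/(edge K a b) (edgeC _ c a).
by rewrite addrA addrC addrA.
Qed.

Lemma triangle_boundary K a b c : [fset a; b; c] \in K ->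
  edge K a b + edge K b c + edge K a c \in boundaries K 1.
Proof. by move/bd_triangle <-; rewrite memv_img ?memvf. Qed.

(** Sum and difference agree modulo 2. The chains need not be cycles: below they are mostly edges
    and paths. *)
Definition homologous K k (c d : chain K k) := c + d \in boundaries K k.

Lemma homologous_refl K k (c : chain K k) : homologous c c.
Proof. by rewrite /homologous addcc mem0v. Qed.

Lemma homologous_sym K k (c d : chain K k) : homologous c d -> homologous d c.
Proof. by rewrite /homologous addrC. Qed.

Lemma homologous_trans K k (c d e : chain K k) :
  homologous c d -> homologous d e -> homologous c e.
Proof.
move=> cd de; have := memvD cd de.
by rewrite -addrA [d + (d + e)]addrA addcc add0r.
Qed.

Lemma homologousD K k (c d c' d' : chain K k) :
  homologous c d -> homologous c' d' -> homologous (c + c') (d + d').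
Proof. by rewrite /homologous addrACA; exact: memvD. Qed.

Lemma homologous0 K k (c : chain K k) : homologous c 0 = (c \in boundaries K k).
Proof. by rewrite /homologous addr0. Qed.

Lemma eq_fset2 (a b c d : T) : a != b -> [fset a; b] = [fset c; d] ->
  a = c /\ b = d \/ a = d /\ b = c.
Proof.
move=> ab e; have : a \in [fset c; d] by rewrite -e !inE eqxx.
have : b \in [fset c; d] by rewrite -e !inE eqxx orbT.
rewrite !inE => /orP[] /eqP eb /orP[] /eqP ea; rewrite ea eb; [|by right|by left|];
  by case/eqP: ab; rewrite ea eb.
Qed.

Lemma cardfs2P A : #|` A| = 2%N -> exists a b, a != b /\ A = [fset a; b].
Proof.
move=> A2; have [a aA] : exists a, a \in A by apply/fset0Pn; rewrite -cardfs_gt0 A2.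
have : #|` A `\ a| == 1%N by move: A2; rewrite (cardfsD1 a) aA add1n => -[->].
case/cardfs1P => b Ab; exists a, b; split; last by rewrite -(fsetD1K aA) Ab.
by have : b \in A `\ a by [rewrite Ab fset11]; rewrite !inE eq_sym => /andP[].
Qed.

Lemma cardfs3P A : #|` A| = 3%N -> exists a b c, A = [fset a; b; c].
Proof.
move=> A3; have [a aA] : exists a, a \in A by apply/fset0Pn; rewrite -cardfs_gt0 A3.
have : #|` A `\ a| = 2%N by move: A3; rewrite (cardfsD1 a) aA add1n => -[->].
by case/cardfs2P => b [c [_ Ab]]; exists a, b, c; rewrite fset3E -(fsetD1K aA) Ab.
Qed.

Lemma pi_homology_eq0 K k (z : subvs_of (cycles K k)) :
  (\pi_(Quotient.quot (@bounding T K k))%qT z == 0) = (vsval z \in boundaries K k).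
Proof.
rewrite -(raddf0 (\pi_(Quotient.quot (@bounding T K k))%qT)) -Quotient.idealrBE.
by rewrite subr0 inE.
Qed.

Lemma homology_map_isomorphism (f : T -> T) K L k :
    simplicial_complex K -> simplicial_map f K L ->
    (forall z, z \in cycles K k -> push f K L k z \in boundaries L k ->
       z \in boundaries K k) ->
    (forall z, z \in cycles L k ->
       exists2 w, w \in cycles K k & push f K L k w = z) ->
  zmod_isomorphism (homology_map f K L k).
Proof.
move=> cK fKL kerf imf.
have add_h : zmod_morphism (homology_map f K L k).
  move=> x y; rewrite -[x]reprK -[y]reprK -raddfB !homology_map_pi //.
  rewrite !linearB; exact: raddfB.
split=> //.
have inj_h : injective (homology_map f K L k).
  move=> x y /eqP; rewrite -subr_eq0 -add_h -[x - y]reprK homology_map_pi //.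
  rewrite pi_homology_eq0 vsprojK ?push_cycles ?subvsP // => /kerf zK.
  by apply/eqP; rewrite -subr_eq0 -[x - y]reprK pi_homology_eq0 zK // subvsP.
have sur_h y : exists x, homology_map f K L k x = y.
  have [w wK wz] := imf (vsval (repr y)) (subvsP _).
  exists (\pi_(Quotient.quot (@bounding T K k))%qT (vsproj _ w)).
  by rewrite homology_map_pi // vsprojK // wz vsvalK reprK.
have [g gK] := choice sur_h; exists g => // x; apply: inj_h; exact: gK.
Qed.

Lemma simplex_vertex K A a : simplicial_complex K -> A \in K -> a \in A -> [fset a] \in K.
Proof.
move=> cK AK aA; apply: cK.2 AK _ _; first by rewrite fsub1set.
by rewrite -cardfs_gt0 cardfs1.
Qed.

Lemma simplex_edge K A a b : simplicial_complex K ->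
  A \in K -> a \in A -> b \in A -> [fset a; b] \in K.
Proof.
move=> cK AK aA bA; apply: cK.2 AK _ _; first by rewrite fsubUset !fsub1set aA.
by apply/fset0Pn; exists a; rewrite !inE eqxx.
Qed.

(** * An isomorphism criterion from chains inside the fibers of a vertex map *)

Section FiberCriterion.
Variables (f : T -> T) (K L : {fset {fset T}}) (gamma : T -> chain K 1).
Hypotheses (cK : simplicial_complex K) (cL : simplicial_complex L).
Hypothesis fKL : simplicial_map f K L.
Hypothesis lift_simplex : forall A, A \in L ->
  exists2 B, B \in K & f @` B = A /\ #|` B| = #|` A|.
Hypothesis bd_gamma : forall p, [fset p] \in K ->
  bd K 0 (gamma p) = vertex K p + vertex K (f p).
Hypothesis push_gamma : forall p, push f K L 1 (gamma p) = 0.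

(** To be read as a path from [f a] through [a] and [b] to [f b]. It lifts the edge from [f a] to
    [f b], because pushing forward kills the two [gamma] terms. *)
Let hook a b := edge K a b + (gamma a + gamma b).

Hypothesis hook_fiber : forall a b a' b',
  [fset a; b] \in K -> [fset a'; b'] \in K -> f a = f a' -> f b = f b' ->
  homologous (hook a b) (hook a' b').

Let hookC a b : hook a b = hook b a.
Proof. by rewrite /hook edgeC [gamma a + _]addrC. Qed.

(** Sending each edge of [L] to a chosen hook above it defines a linear map [lam]. It is a right
    inverse of the push-forward on chains, maps cycles to cycles and boundaries to boundaries, and
    by [hook_fiber] it is a left inverse on cycles up to boundaries. *)
Lemma fiber_criterion : zmod_isomorphism (homology_map f K L 1).
Proof.
have exg A : exists c, A \in simplices L 1 ->
    exists a b, [/\ [fset a; b] \in K, A = [fset f a; f b] & c = hook a b].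
  have [AL|] := boolP (A \in simplices L 1); last by exists 0.
  have [AinL A2] : A \in L /\ #|` A| = 2%N := simplicesP [` AL].
  have [B BK [fB B2]] := lift_simplex AinL.
  rewrite A2 in B2; have [a [b [_ BE]]] := cardfs2P B2.
  exists (hook a b) => _; exists a, b; rewrite -BE BK -fB BE.
  by split=> //; rewrite imfset_fset2.
have [g gP] := choice exg; pose lam := @lin_ext L 1 (chain K 1) g.
have lam_push a b : [fset a; b] \in K ->
    homologous (lam (push f K L 1 (edge K a b))) (hook a b).
  move=> abK; rewrite push_edge //; have [fab|fab] := eqVneq (f a) (f b).
    (* The pushed edge is 0 here, and the hook of [a] and [b] is compared with the degenerate hook
       of [a] and [a], which is 0 as well. *)
    rewrite fab edge_id linear0; apply: homologous_sym.
    have aaK : [fset a; a] \in K by rewrite fsetUid (simplex_vertex cK abK) ?fset21.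
    apply: homologous_trans (hook_fiber abK aaK _ _) _ => //.
    by rewrite /hook edge_id addcc addr0 homologous_refl.
  have fabL : [fset f a; f b] \in simplices L 1.
    by rewrite simplices_in ?cardfs2 ?fab // -imfset_fset2 fKL.
  rewrite [lam _]lin_ext_simplex //; have [a' [b' [abK' fE ->]]] := gP _ fabL.
  apply: homologous_sym.
  case: (eq_fset2 fab fE) => -[ea eb]; last rewrite hookC.
    exact: hook_fiber.
  by apply: hook_fiber => //; rewrite fsetUC.
apply: homology_map_isomorphism => // z; rewrite memv_ker => /eqP bdz.
  move=> /memv_imgP[d _ pushz].
  (* On an edge, [hg \o bd K 0] and the identity add up to its hook, so [lam_push] makes [Phi] of
     the edge a boundary. On the cycle [z] the term [hg \o bd K 0] vanishes, hence [lam] of the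
     pushed [z] is homologous to [z]. *)
  pose hg := @lin_ext K 0 (chain K 1) (fun A => \sum_(x <- A) gamma x).
  pose Phi := (lam \o push f K L 1 + (hg \o bd K 0 + \1))%VF.
  have PhiB : Phi z \in boundaries K 1.
    apply: lfun_simplex_mem => A AK; have [AinK A2] : A \in K /\ #|` A| = 2%N := simplicesP [` AK].
    have [a [b [ab AE]]] := cardfs2P A2; subst A.
    rewrite !(add_lfunE, comp_lfunE) id_lfunE [X in _ + X]addrC -/(edge K a b).
    rewrite bd_edge // linearD /=.
    rewrite /hg !lin_ext_simplex; last 2 first.
    - by apply: simplices_in; rewrite ?cardfs1 // (simplex_vertex cK AinK) ?fset22.
    - by apply: simplices_in; rewrite ?cardfs1 // (simplex_vertex cK AinK) ?fset21.
    rewrite !big_seq_fset1; exact: lam_push.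
  (* A triangle of [L] is the image of a triangle of [K]. The three hooks over its sides add up to
     the boundary of the latter, since each [gamma] occurs twice. *)
  have : lam (bd L 1 d) \in boundaries K 1.
    rewrite -[lam _]comp_lfunE; apply: lfun_simplex_mem => A AL.
    have [AinL A3] : A \in L /\ #|` A| = 3%N := simplicesP [` AL].
    have [B BK [fB B3]] := lift_simplex AinL.
    rewrite A3 in B3; have [a [b [c BE]]] := cardfs3P B3; subst B.
    have [aB bB cB] : [/\ a \in [fset a; b; c], b \in [fset a; b; c] &
      c \in [fset a; b; c]] by rewrite !inE !eqxx !orbT.
    have [abK bcK acK] := And3 (simplex_edge cK BK aB bB) (simplex_edge cK BK bB cB)
      (simplex_edge cK BK aB cB).
    have -> : simplex_chain L 2 A = push f K L 2 (simplex_chain K 2 [fset a; b; c]).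
      by rewrite push_simplex // fB.
    rewrite comp_lfunE push_bd //.
    rewrite bd_triangle // !linearD /= -homologous0.
    apply: homologous_trans (homologousD (homologousD (lam_push _ _ abK)
      (lam_push _ _ bcK)) (lam_push _ _ acK)) _.
    rewrite homologous0 /hook (addrACA (edge K a b)).
    rewrite (addrACA (edge K a b + edge K b c)) -[X in _ + X]addrA.
    rewrite (addrACA (gamma b)) addcc addr0 (addrC (gamma b)) addcc addr0.
    exact: triangle_boundary.
  rewrite -pushz => lamB; have := memvD PhiB lamB.
  rewrite /Phi !(add_lfunE, comp_lfunE) id_lfunE bdz linear0 add0r addrC addrA addcc.
  by rewrite add0r.
exists (lam z).
  (* [iota] copies vertices of [L] to 0-chains of [K]. A hook has boundary
     [vertex K (f a) + vertex K (f b)], so [lam] intertwines the two boundary maps and preserves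
     cycles. *)
  pose iota := @lin_ext L 0 (chain K 0) (simplex_chain K 0).
  have bd_lam : (bd K 0 \o lam)%VF =1 (iota \o bd L 0)%VF.
    apply: eq_lfun_simplex => A AL; rewrite !comp_lfunE lin_ext_simplex //.
    have [a [b [abK AE ->]]] := gP _ AL; subst A.
    have [fabL _] : [fset f a; f b] \in L /\ _ := simplicesP [` AL].
    rewrite -/(edge L _ _) bd_edge // !linearD /= !lin_ext_simplex; last 2 first.
    - by apply: simplices_in; rewrite ?cardfs1 // (simplex_vertex cL fabL) ?fset22.
    - by apply: simplices_in; rewrite ?cardfs1 // (simplex_vertex cL fabL) ?fset21.
    rewrite bd_edge // !bd_gamma ?(simplex_vertex cK abK) ?fset21 ?fset22 //.
    by rewrite addrACA (addrA (vertex K a)) (addrA (vertex K b)) !addcc !add0r.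
  by rewrite [_ \in _]memv_ker -comp_lfunE bd_lam comp_lfunE bdz linear0.
have push_lam : (push f K L 1 \o lam)%VF =1 \1%VF.
  apply: eq_lfun_simplex => A AL; rewrite comp_lfunE id_lfunE lin_ext_simplex //.
  have [a [b [abK AE ->]]] := gP _ AL.
  by rewrite !linearD /= !push_gamma !addr0 push_edge // AE.
by rewrite -comp_lfunE push_lam id_lfunE.
Qed.
End FiberCriterion.

(** * Boundaries of strips, grids and fans of triangles *)

Lemma addcKK K k (c d e : chain K k) : c + d + (d + e) = c + e.
Proof. by rewrite -addrA [d + (d + e)]addrA addcc add0r. Qed.

Definition seq_chain K (s : nat -> T) N : chain K 1 :=
  \sum_(i < N) edge K (s i) (s i.+1).

Lemma homologous_telescope K (s : nat -> T) (c : nat -> chain K 1) N :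
  (forall i, (i < N)%N -> homologous (edge K (s i) (s i.+1)) (c i + c i.+1)) ->
  homologous (seq_chain K s N) (c 0 + c N).
Proof.
rewrite /seq_chain; elim: N => [|N IHN] sc.
  by rewrite big_ord0 addcc homologous_refl.
rewrite big_ord_recr /=.
have := homologousD (IHN (fun i iN => sc i (ltnW iN))) (sc N (ltnSn N)).
by rewrite addcKK.
Qed.

(** The quadrilateral with sides [ab], [bd], [dc], [ca], filled by two triangles along the diagonal
    [ad]. *)
Definition square K (a b c d : T) :=
  [fset a; b; d] \in K /\ [fset a; c; d] \in K.

Lemma square_boundary K a b c d : square K a b c d ->
  homologous (edge K a b + edge K c d) (edge K a c + edge K b d).
Proof.
move=> [abd acd]; have := memvD (triangle_boundary abd) (triangle_boundary acd).
rewrite /homologous addrACA addcc addr0 (addrC (edge K a c)) addrACA.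
by rewrite (addrC (edge K b d)).
Qed.

Lemma strip_boundary K (s t : nat -> T) N :
  (forall i, (i < N)%N -> square K (s i) (s i.+1) (t i) (t i.+1)) ->
  homologous (seq_chain K s N + seq_chain K t N)
    (edge K (s 0) (t 0) + edge K (s N) (t N)).
Proof.
rewrite /seq_chain; elim: N => [|N IHN] st.
  by rewrite !big_ord0 !addcc homologous_refl.
rewrite !big_ord_recr /= addrACA.
have := homologousD (IHN (fun i iN => st i (ltnW iN))) (square_boundary (st N (ltnSn N))).
by rewrite addcKK.
Qed.

(** The rows are stacked as strips; inner rows occur twice and cancel, which leaves the four sides
    of the grid. *)
Lemma grid_boundary K (G : nat -> nat -> T) N N' :
  (forall i j, (i < N)%N -> (j < N')%N ->
     square K (G i j) (G i.+1 j) (G i j.+1) (G i.+1 j.+1)) ->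
  homologous (seq_chain K (G^~ 0) N + seq_chain K (G^~ N') N)
    (seq_chain K (G 0) N' + seq_chain K (G N) N').
Proof.
elim: N' => [|N' IHN] gridG.
  by rewrite addcc /seq_chain !big_ord0 addcc homologous_refl.
have := homologousD (IHN (fun i j iN jN => gridG i j iN (ltnW jN)))
  (strip_boundary (fun i iN => gridG i N' iN (ltnSn N'))).
by rewrite addcKK addrACA /seq_chain !(@big_ord_recr _ _ _ N').
Qed.

Lemma cone_boundary K u (s : nat -> T) N :
  (forall i, (i < N)%N -> [fset u; s i; s i.+1] \in K) ->
  homologous (seq_chain K s N) (edge K u (s 0) + edge K u (s N)).
Proof.
move=> us; apply: (@homologous_telescope _ _ (fun i => edge K u (s i))) => i iN.
by have := triangle_boundary (us i iN); rewrite /homologous addrAC addrC addrA.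
Qed.

End Chains.

(** * Nearest points *)

Section Euclid.
Variables (R : realType) (n : nat).
Local Notation E := 'rV[R]_n.
Implicit Types (x y z u v w : E) (a b t : R).

(** * Euclidean norm and distance, and existence of nearest points *)

Definition dot u v : R := \sum_(i < n) u ord0 i * v ord0 i.
Definition enorm u : R := Num.sqrt (dot u u).

Lemma eucl_distE x y : eucl_dist x y = enorm (x - y).
Proof.
by congr Num.sqrt; apply: eq_bigr => i _; rewrite !mxE expr2.
Qed.

Lemma dotC u v : dot u v = dot v u.
Proof. by apply: eq_bigr => i _; rewrite mulrC. Qed.

Lemma dotDl u v w : dot (u + v) w = dot u w + dot v w.
Proof. by rewrite -big_split; apply: eq_bigr => i _; rewrite !mxE mulrDl. Qed.

Lemma dotZl a u w : dot (a *: u) w = a * dot u w.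
Proof. by rewrite /dot mulr_sumr; apply: eq_bigr => i _; rewrite !mxE mulrA. Qed.

Lemma dotNl u w : dot (- u) w = - dot u w.
Proof. by rewrite -scaleN1r dotZl mulN1r. Qed.

Lemma dotDr u v w : dot w (u + v) = dot w u + dot w v.
Proof. by rewrite dotC dotDl ![dot _ w]dotC. Qed.

Lemma dotZr a u w : dot w (a *: u) = a * dot w u.
Proof. by rewrite dotC dotZl dotC. Qed.

Lemma dotNr u w : dot w (- u) = - dot w u.
Proof. by rewrite dotC dotNl dotC. Qed.

Definition dotE := (dotDl, dotDr, dotNl, dotNr, dotZl, dotZr).

Lemma dot_ge0 u : 0 <= dot u u.
Proof. by apply: sumr_ge0 => i _; rewrite -expr2 sqr_ge0. Qed.

Lemma dot_eq0 u : dot u u = 0 -> u = 0.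
Proof.
move=> /eqP; rewrite psumr_eq0 => [/allP u0|i _]; last by rewrite -expr2 sqr_ge0.
apply/rowP => i; rewrite mxE; apply/eqP.
by have := u0 i (mem_index_enum i); rewrite /= -expr2 sqrf_eq0.
Qed.

Lemma enorm_ge0 u : 0 <= enorm u.
Proof. exact: sqrtr_ge0. Qed.

Lemma sqr_enorm u : enorm u ^+ 2 = dot u u.
Proof. by rewrite sqr_sqrtr // dot_ge0. Qed.

Lemma enorm_le u a : 0 <= a -> dot u u <= a ^+ 2 -> enorm u <= a.
Proof.
by move=> a0; rewrite -sqr_enorm ler_pXn2r // nnegrE // enorm_ge0.
Qed.

Lemma enorm_eq0 u : enorm u = 0 -> u = 0.
Proof. by move=> u0; apply: dot_eq0; rewrite -sqr_enorm u0 expr0n. Qed.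

Lemma enorm0 : enorm 0 = 0.
Proof. by rewrite /enorm /dot big1 ?sqrtr0 // => i _; rewrite mxE mul0r. Qed.

Lemma enormZ a u : enorm (a *: u) = `|a| * enorm u.
Proof.
by rewrite /enorm !dotE mulrA -expr2 sqrtrM ?sqr_ge0 // sqrtr_sqr.
Qed.

Lemma enormN u : enorm (- u) = enorm u.
Proof. by rewrite /enorm !dotE opprK. Qed.

Lemma dot_le_enorm u v : dot u v <= enorm u * enorm v.
Proof.
have [u0|u0] := eqVneq (enorm u) 0.
  by rewrite u0 (enorm_eq0 u0) -(scale0r 0) dotZl !mul0r.
have up : 0 < enorm u by rewrite lt_def u0 enorm_ge0.
have [v0|v0] := eqVneq (enorm v) 0.
  by rewrite v0 (enorm_eq0 v0) -(scale0r 0) dotZr mul0r mulr0.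
have vp : 0 < enorm v by rewrite lt_def v0 enorm_ge0.
have := dot_ge0 (enorm v *: u - enorm u *: v).
rewrite !dotE (dotC v u) -!sqr_enorm => h.
have {}h : 0 <= (2 * (enorm u * enorm v)) * (enorm u * enorm v - dot u v) by lra.
by move: h; rewrite pmulr_rge0 ?subr_ge0 // mulr_gt0 ?mulr_gt0.
Qed.

Lemma enormD u v : enorm (u + v) <= enorm u + enorm v.
Proof.
apply: enorm_le; first by rewrite addr_ge0 ?enorm_ge0.
have := dot_le_enorm u v; rewrite !dotE (dotC v u) -!sqr_enorm; lra.
Qed.

Lemma eucl_distC x y : eucl_dist x y = eucl_dist y x.
Proof. by rewrite !eucl_distE -enormN opprB. Qed.

Lemma eucl_dist_ge0 x y : 0 <= eucl_dist x y.
Proof. exact: sqrtr_ge0. Qed.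

Lemma eucl_distxx x : eucl_dist x x = 0.
Proof. by rewrite eucl_distE subrr enorm0. Qed.

Lemma eucl_dist_eq0 x y : eucl_dist x y = 0 -> x = y.
Proof. by rewrite eucl_distE => /enorm_eq0 /eqP; rewrite subr_eq0 => /eqP. Qed.

Lemma eucl_dist_triangle y x z :
  eucl_dist x z <= eucl_dist x y + eucl_dist y z.
Proof. by rewrite !eucl_distE; have := enormD (x - y) (y - z); rewrite addrA subrK. Qed.

(** [ball] refers to the sup norm. The factor [sqrt n] would do; [n] avoids the root. *)
Lemma ball_enorm x y e : ball x e y -> enorm (x - y) <= n%:R * e.
Proof.
move=> [e0 xy]; apply: enorm_le; first by rewrite mulr_ge0 // ltW.
apply: (@le_trans _ _ (\sum_(i < n) e ^+ 2)).
  apply: ler_sum => i _; rewrite !mxE -expr2 -[leLHS]real_normK ?num_real //.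
  have xyi : `|x ord0 i - y ord0 i| < e := xy ord0 i.
  by rewrite ler_pXn2r ?nnegrE ?normr_ge0 ?(ltW e0) ?(ltW xyi).
rewrite sumr_const card_ord exprMn -[leLHS]mulr_natl ler_wpM2r ?sqr_ge0 //.
by rewrite -natrX ler_nat; case: (n) => // m; exact: leq_pmulr.
Qed.

Lemma continuous_1lipschitz (f : E -> R) :
  (forall x y, f x - f y <= enorm (x - y)) -> continuous f.
Proof.
move=> lipf x; have FF := nbhs_filter (x : E).
apply/(@cvgrPdist_lt _ _ _ (nbhs (x : E)) FF) => e e0; apply/nbhs_ballP.
(* [n.+1] instead of [n] makes the estimate strict and covers dimension 0. *)
exists (e / n.+1%:R) => /= [|y /ball_enorm xy]; first by rewrite divr_gt0.
have {xy} : enorm (x - y) < e.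
  apply: le_lt_trans xy _; rewrite mulrC -mulrA gtr_pMr // mulrC ltr_pdivrMr //.
  by rewrite mul1r ltr_nat.
rewrite ltr_norml; have := lipf x y; have := lipf y x.
by rewrite -(opprB x y) enormN; lra.
Qed.

Lemma coord_le_enorm u i : `|u ord0 i| <= enorm u.
Proof.
rewrite -sqrtr_sqr ler_wsqrtr // expr2 /dot (bigD1 i) //= lerDl sumr_ge0 // => j _.
by rewrite -expr2 sqr_ge0.
Qed.

Lemma continuous_enormB x : continuous (fun y => enorm (y - x)).
Proof.
by apply: continuous_1lipschitz => y z; rewrite lerBlDr -[y - x](subrKA z) enormD.
Qed.

Lemma compact_eball x r : compact [set y | enorm (y - x) <= r].
Proof.
have box : compact [set y : E | forall i, `[x ord0 i - r, x ord0 i + r]%classic (y ord0 i)].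
  apply: (@rV_compact R n (fun i => `[x ord0 i - r, x ord0 i + r]%classic)) => i.
  exact: segment_compact.
apply: subclosed_compact box _ => [|y /= yx i].
  have -> : [set y | enorm (y - x) <= r] =
    (fun y => enorm (y - x)) @^-1` [set a | a <= r] by [].
  by apply: preimage_closed; [move=> y _; exact: continuous_enormB|exact: closed_le].
have := le_trans (coord_le_enorm (y - x) i) yx.
by rewrite !mxE ler_norml in_itv /= => /andP[lo hi]; apply/andP; split; lra.
Qed.

Lemma exists_nearest (M : set E) x :
  compact M -> M !=set0 -> exists y, nearest_in M x y.
Proof.
move=> cM M0.
have [|y /set_mem My ymin] := @compact_EVT_min _ R (fun y => enorm (y - x)) M M0 cM.
  exact/continuous_subspaceT/continuous_enormB.
exists y; split=> // z Mz; rewrite !(eucl_distC x) !eucl_distE.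
exact/ymin/mem_set.
Qed.

Lemma reach_unique_nearest (M : set E) rho x y z :
  (rho%:E <= reach M)%E -> nearest_in M x y -> nearest_in M x z ->
  eucl_dist x y < rho -> y = z.
Proof.
move=> rhoM xy xz; apply: contraPP => yz; apply/negP; rewrite -leNgt -lee_fin.
apply: le_trans rhoM _; rewrite eucl_distC; apply: ereal_inf_lbound.
exists y; first by case: xy.
by exists x => //; apply: subset_closure; exists y, z.
Qed.

(** * The nearest point map within the reach *)

Section NearestPoint.
Variables (M : set E) (pi : E -> E) (rho : R).
Hypothesis cM : compact M.
Hypothesis piM : forall x, M (pi x).
Hypothesis pi_min : forall x y, M y -> enorm (x - pi x) <= enorm (x - y).
Hypothesis pi_unique : forall x y, enorm (x - pi x) < rho -> M y ->
  enorm (x - y) <= enorm (x - pi x) -> y = pi x.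

Local Notation d x := (enorm (x - pi x)).

Lemma dist_1lipschitz x y : d x - d y <= enorm (x - y).
Proof.
rewrite lerBlDr (le_trans (pi_min x (piM y))) //.
by rewrite -[x - pi y](subrKA y) enormD.
Qed.

Lemma dist_continuous : continuous (fun x : E => d x).
Proof. exact: continuous_1lipschitz dist_1lipschitz. Qed.

(** The part of [M] at distance at least [eta] from [pi z] is compact, and by uniqueness its
    distance to [z] exceeds [d z] by a positive gap. *)
Lemma nearest_continuous z eta : d z < rho -> 0 < eta ->
  exists2 w, 0 < w & forall x, enorm (x - z) <= w -> enorm (pi x - pi z) < eta.
Proof.
move=> dz eta0; pose A := (M `&` [set y | eta <= enorm (y - pi z)])%classic.
have [A0|/set0P A0] := eqVneq A set0.
  exists 1 => // x _; rewrite ltNge; apply/negP => far.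
  by have : A (pi x) by []; rewrite A0.
have cA : compact A.
  apply: compact_closedI => //.
  have -> : [set y | eta <= enorm (y - pi z)] =
    (fun y => enorm (y - pi z)) @^-1` [set a | eta <= a] by [].
  by apply: preimage_closed; [move=> y _; exact: continuous_enormB|exact: closed_ge].
have [|y /set_mem [My yfar] ymin] := @compact_EVT_min _ R (fun y => enorm (y - z)) A A0 cA.
  exact/continuous_subspaceT/continuous_enormB.
have dzy : d z < enorm (y - z).
  rewrite ltNge; apply/negP; rewrite -enormN opprB => /(pi_unique dz My) yz.
  by move: yfar; rewrite /= yz subrr enorm0 leNgt eta0.
(* With [w] a third of the gap, [enorm (pi x - z)] is at most [d x + w], hence at most
   [d z + 2 * w], which falls short of the gap. *)
exists ((enorm (y - z) - d z) / 3); first by rewrite divr_gt0 // subr_gt0.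
move=> x xz; rewrite ltNge; apply/negP => far.
have := ymin (pi x) (mem_set (conj (piM x) far)).
have := enormD (pi x - x) (x - z); rewrite addrA subrK -[enorm (pi x - x)]enormN opprB.
have := dist_1lipschitz x z; lra.
Qed.

(** Moving from [z] straight away from [pi z] increases the distance to [M] at a rate close to 1,
    because by continuity the nearest point hardly moves. *)
Lemma dist_ascent z k r : 0 < d z -> d z < rho -> 0 < k <= 1 -> 0 < r ->
  exists2 w, 0 < enorm (w - z) <= r & d z + (1 - k) * enorm (w - z) < d w.
Proof.
move=> D0 dz /andP[k0 k1] r0; set D := d z in D0 dz *.
have [w w0 wP] := nearest_continuous dz (mulr_gt0 (divr_gt0 k0 (ltr0n _ 2)) D0).
pose s := Num.min w r / D.
have sD : s * D = Num.min w r by rewrite divfK // gt_eqF.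
have s0 : 0 < s by rewrite divr_gt0 // lt_min w0.
exists (z + s *: (z - pi z)); set x := z + _;
  have xz : enorm (x - z) = s * D by rewrite /x addrC addKr enormZ gtr0_norm.
  by rewrite xz sD lt_min w0 r0 ge_min lexx orbT.
have /wP : enorm (x - z) <= w by rewrite xz sD ge_min lexx.
rewrite xz; set y := pi x => yz.
have zy := pi_min z (piM x : M y).
have cs := dot_le_enorm (z - pi z) (y - pi z).
(* The inner product is at most [k / 2 * D ^+ 2] and [enorm (z - y)] is at least [D]. The right side
   thus exceeds [(D + (1 - k) * (s * D)) ^+ 2] by at least
   [D ^+ 2 * (s * k + s ^+ 2 * k * (2 - k))]. *)
have expand : enorm (x - y) ^+ 2 =
    enorm (z - y) ^+ 2 + 2 * s * (D ^+ 2 - dot (z - pi z) (y - pi z)) + (s * D) ^+ 2.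
  by rewrite exprMn /D !sqr_enorm /x !dotE (dotC (pi z) z) (dotC y z) (dotC y (pi z)); ring.
rewrite -/D in cs zy.
have yD : dot (z - pi z) (y - pi z) <= k / 2 * D * D.
  by apply: le_trans cs _; rewrite mulrC ler_pM2r // ltW.
rewrite -(@ltr_pXn2r _ 2) ?nnegrE ?enorm_ge0 //; last first.
  apply: addr_ge0; first exact: ltW.
  by apply: mulr_ge0; [rewrite subr_ge0|apply: mulr_ge0; exact: ltW].
have zy2 : D ^+ 2 <= enorm (z - y) ^+ 2 by rewrite ler_pXn2r ?nnegrE ?enorm_ge0 ?(ltW D0).
have sy : s * dot (z - pi z) (y - pi z) <= s * (k / 2 * D * D) by rewrite ler_pM2l.
have sk : 0 < s * k * D ^+ 2 by apply: mulr_gt0; [apply: mulr_gt0|apply: exprn_gt0].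
have sk2 : 0 <= s ^+ 2 * D ^+ 2 * k * (2 - k).
  have k2 : 0 <= 2 - k by lra.
  by apply: mulr_ge0 => //; apply: mulr_ge0; [apply: mulr_ge0; exact: sqr_ge0|exact: ltW].
rewrite expand; move: zy2 sy sk sk2; move: (dot _ _) (enorm (z - y)) => A B; nra.
Qed.

(* Ekeland's argument: a maximum of [d - (1 - k) |. - x|] on the closed ball
   must lie on its boundary, since otherwise [dist_ascent] improves it. *)
Lemma dist_grows x s k : 0 < d x -> 0 <= s -> d x + s < rho -> 0 < k <= 1 ->
  exists2 z, enorm (z - x) = s & d x + (1 - k) * s <= d z.
Proof.
move=> dx s0 sx k01; pose f z := d z - (1 - k) * enorm (z - x).
have [k0 k1] := andP k01.
pose B := [set z | enorm (z - x) <= s].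
have B0 : B !=set0 by exists x; rewrite /B /= subrr enorm0.
have cf : continuous (f : E -> R).
  move=> z; have FF := nbhs_filter (z : E).
  apply: (@cvgB _ _ _ _ FF); first exact: dist_continuous.
  by apply: (@cvgMr _ _ _ FF); exact: continuous_enormB.
have [|z /set_mem zB zmax] := @compact_EVT_max _ R f B B0 (@compact_eball x s).
  exact: continuous_subspaceT.
have fx : f x <= f z by apply: zmax; apply/mem_set; rewrite /B /= subrr enorm0.
rewrite /f subrr enorm0 mulr0 subr0 in fx.
have zs : enorm (z - x) <= s by [].
have kz : 0 <= (1 - k) * enorm (z - x) by rewrite mulr_ge0 ?enorm_ge0 ?subr_ge0.
have dzx : d z - d x <= enorm (z - x) := dist_1lipschitz z x.
have [zlt|zge] := ltP (enorm (z - x)) s; last first.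
  have ez : enorm (z - x) = s by apply/eqP; rewrite eq_le zs.
  by exists z => //; rewrite -ez; lra.
have [| | | |w /andP[w0 wr] dw] := @dist_ascent z k (s - enorm (z - x));
  [lra|lra|exact: k01|lra|].
have wzx : enorm (w - x) <= enorm (w - z) + enorm (z - x).
  by rewrite -[w - x](subrKA z) enormD.
have : f w <= f z by apply: zmax; apply/mem_set; rewrite /B /=; lra.
have : (1 - k) * enorm (w - x) <= (1 - k) * (enorm (w - z) + enorm (z - x)).
  by rewrite ler_wpM2l ?subr_ge0.
rewrite /f; lra.
Qed.

(** The limit of [dist_grows] as [k] tends to 0: the maximum of [d] on the ball is attained, so it
    cannot stay below [d x + s]. *)
Lemma dist_grows_max x s : 0 < d x -> 0 <= s -> d x + s < rho ->
  exists2 z, enorm (z - x) <= s & d x + s <= d z.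
Proof.
move=> dx s0 sx; pose B := [set z | enorm (z - x) <= s].
have B0 : B !=set0 by exists x; rewrite /B /= subrr enorm0.
have [|z /set_mem zB zmax] := @compact_EVT_max _ R (fun z => d z) B B0 (@compact_eball x s).
  exact/continuous_subspaceT/dist_continuous.
exists z => //; rewrite leNgt; apply/negP => lt.
have [s00|sp] := eqVneq s 0.
  have := zmax x; rewrite inE /B /= subrr enorm0 => /(_ s0); lra.
have {}sp : 0 < s by rewrite lt_def sp.
(* With this [k], the loss [k * s] is at most half of the assumed deficit [d x + s - d z]. *)
pose k := Num.min 1 ((d x + s - d z) / (2 * s)).
have k0 : 0 < k by rewrite lt_min ltr01 divr_gt0 ?subr_gt0 // mulr_gt0.
have [|w ws dw] := @dist_grows x s k dx s0 sx; first by rewrite k0 ge_min lexx.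
have : d w <= d z by apply: zmax; apply/mem_set; rewrite /B /= ws.
have : k * s <= (d x + s - d z) / 2.
  rewrite -(@ler_pdivlMr _ s) // -mulrA -invfM /k ge_min; apply/orP; right => //.
lra.
Qed.

(* Federer, Curvature measures, Theorem 4.8. *)
Lemma tangent_ball x r w : 0 < d x <= r -> r < rho -> M w ->
  r <= enorm (pi x + (r / d x) *: (x - pi x) - w).
Proof.
move=> /andP[dx dr] rr Mw; set D := d x in dx dr *; pose s := r - D.
have [| |z zx dz] := @dist_grows_max x s dx; rewrite /s; [lra|by rewrite -/D; lra|].
rewrite -/D in dz zx.
have zpi : enorm (z - pi x) <= enorm (z - x) + D.
  by rewrite -[z - pi x](subrKA x) enormD.
have dz2 := pi_min z (piM x).
have ezx : enorm (z - x) = s by rewrite /s in zx dz *; lra.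
have ezp : enorm (z - pi x) = s + D by rewrite /s in zx dz *; lra.
(* The triangle inequality for [pi x], [x], [z] is an equality, so [z] lies on the ray from [pi x]
   through [x]: it is the center of the tangent ball of radius [r]. *)
have zE : z = pi x + (r / D) *: (x - pi x).
  have par : D *: (z - x) - s *: (x - pi x) = 0.
    apply: dot_eq0; have := sqr_enorm (z - pi x); rewrite ezp.
    rewrite -[z - pi x](subrKA x).
    have := sqr_enorm (z - x); have := sqr_enorm (x - pi x); rewrite ezx -/D.
    move: (z - x) (x - pi x) => a b bb aa.
    rewrite !dotE (dotC b a) -aa -bb => ab.
    have {}ab : dot a b = s * D by lra.
    by rewrite ab; ring.
  apply/rowP => i; have := congr1 (fun u : E => u ord0 i) par; rewrite !mxE /s => pari.
  apply: (mulfI (lt0r_neq0 dx)); rewrite mulrDr mulrA (mulrC D (r / D)).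
  by rewrite divfK ?lt0r_neq0 //; lra.
by rewrite -zE; have := pi_min z Mw; rewrite /s in dz; lra.
Qed.

(** The inequality of [tangent_ball], squared and expanded: directions from [pi x] to points of [M]
    are orthogonal to [x - pi x] up to second order. *)
Lemma dot_nearest x r w : d x <= r -> 0 < r < rho -> M w ->
  2 * r * dot (x - pi x) (w - pi x) <= d x * enorm (w - pi x) ^+ 2.
Proof.
move=> dr /andP[r0 rr] Mw; have [d0|d0] := eqVneq (d x) 0.
  by rewrite d0 (enorm_eq0 d0) -(scale0r 0) dotZl !mul0r mulr0.
have dp : 0 < d x by rewrite lt_def d0 enorm_ge0.
have := @tangent_ball x r w; rewrite dp dr => /(_ isT rr Mw).
set D := d x in d0 dp dr *.
have -> : pi x + (r / D) *: (x - pi x) - w = (r / D) *: (x - pi x) - (w - pi x).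
  by rewrite opprB addrCA addrA.
have := sqr_enorm (x - pi x); rewrite -/D.
have := sqr_enorm (w - pi x).
move: (x - pi x) (w - pi x) => e f ff ee tb.
have {tb} : r ^+ 2 <= enorm ((r / D) *: e - f) ^+ 2.
  by rewrite ler_pXn2r ?nnegrE ?enorm_ge0 ?(ltW r0).
rewrite sqr_enorm !dotE (dotC f e) -ee -ff => h.
have {h} : 2 * (r / D) * dot e f <= enorm f ^+ 2.
  have : (r / D) * ((r / D) * D ^+ 2) = r ^+ 2 by field.
  lra.
have -> : 2 * (r / D) * dot e f = 2 * r * dot e f / D by field.
by rewrite ler_pdivrMr // (mulrC D).
Qed.

(** Two instances of [dot_nearest], at [x] with [w = pi y] and at [y] with [w = pi x], are added.
    Since [d x + d y] is at most [4 / 3 * r], a third of the quadratic term [2 * r * F ^+ 2]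
    survives, hence the constant 3. *)
Lemma nearest_lipschitz r x y : 3 * d x <= 2 * r -> 3 * d y <= 2 * r ->
  0 < r < rho -> enorm (pi x - pi y) <= 3 * enorm (x - y).
Proof.
move=> dx dy r0r; have [r0 rr] := andP r0r.
have xr : d x <= r by lra.
have yr : d y <= r by lra.
have := dot_nearest xr r0r (piM y); have := dot_nearest yr r0r (piM x).
move: dx dy {xr yr}; move: (d x) (d y) => Dx Dy dx dy.
have -> : pi y - pi x = - (pi x - pi y) by rewrite opprB.
have -> : y - pi y = - (x - y) + (x - pi x) + (pi x - pi y).
  by rewrite opprB !addrA subrK subrK.
rewrite enormN; have := dot_le_enorm (x - y) (pi x - pi y).
have ff := sqr_enorm (pi x - pi y).
have f0 := enorm_ge0 (pi x - pi y); move: f0 ff.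
move: (enorm (pi x - pi y)) => F f0.
move: (x - y) (x - pi x) (pi x - pi y) => e g f.
rewrite !dotE => ff ef hy hx; have [F0|F0] := eqVneq F 0.
  by rewrite F0 mulr_ge0 // enorm_ge0.
have {f0}F0 : 0 < F by rewrite lt_def F0.
rewrite -(ler_pM2r F0) -(@ler_pM2l _ (2 * r)) ?mulr_gt0 //.
rewrite -ff in hx hy.
have hxy : (Dx + Dy) * F ^+ 2 <= (4 / 3 * r) * F ^+ 2.
  by rewrite ler_wpM2r ?sqr_ge0 //; lra.
have : 2 * r * dot e f <= 2 * r * (enorm e * F) by rewrite ler_pM2l ?mulr_gt0.
lra.
Qed.

(** [dot_nearest] at [p] and [q] gives [2 * r * D <= D ^+ 2 + a ^+ 2 / 4]; the crude bound
    [D <= a / 2], from [t <= 1/2], and [a <= r] then improve to [D <= a / 4]. *)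
Lemma dist_segment r p q t : M p -> M q -> enorm (q - p) <= r -> 0 < r < rho ->
  0 <= t <= 2^-1 -> 4 * d (p + t *: (q - p)) <= enorm (q - p).
Proof.
move=> Mp Mq pqr r0r t01; have [r0 rr] := andP r0r; have [t0 t1] := andP t01.
set x := p + _; set a := enorm (q - p) in pqr *.
have a0 : 0 <= a := enorm_ge0 _.
have xa : d x <= a / 2.
  apply: le_trans (pi_min x Mp) _; rewrite /x addrC addKr enormZ ger0_norm // -/a.
  by rewrite mulrC ler_wpM2l.
have xr : d x <= r by lra.
have := dot_nearest xr r0r Mp; have := dot_nearest xr r0r Mq.
have -> : q - pi x = (1 - t) *: (q - p) + (x - pi x).
  by apply/rowP => i; rewrite !mxE; ring.
have -> : p - pi x = - t *: (q - p) + (x - pi x).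
  by apply/rowP => i; rewrite !mxE; ring.
have aa := sqr_enorm (q - p); rewrite -/a in aa.
have ee := sqr_enorm (x - pi x); have := enorm_ge0 (x - pi x).
rewrite !sqr_enorm; move: xa xr ee; move: (d x) => D xa xr.
move: (x - pi x) (q - p) aa => e f aa ee D0.
rewrite !dotE (dotC f e) -ee -aa; set c := dot e f => hq hp.
(* The weights [t] for [q] and [1 - t] for [p] eliminate the unknown inner product [c]. *)
have h : 2 * r * D ^+ 2 <= D * (D ^+ 2 + t * (1 - t) * a ^+ 2).
  have : t * (2 * r * ((1 - t) * c + D ^+ 2)) <=
    t * (D * ((1 - t) * ((1 - t) * a ^+ 2 + c) + ((1 - t) * c + D ^+ 2))).
    by apply: ler_wpM2l => //; lra.
  have : (1 - t) * (2 * r * (- t * c + D ^+ 2)) <=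
    (1 - t) * (D * (- t * (- t * a ^+ 2 + c) + (- t * c + D ^+ 2))).
    by apply: ler_wpM2l; lra.
  lra.
have [D00|Dn0] := eqVneq D 0; first by rewrite D00 mulr0.
have {}D0 : 0 < D by rewrite lt_def Dn0.
have {}h : 2 * r * D <= D ^+ 2 + t * (1 - t) * a ^+ 2.
  by rewrite -(ler_pM2l D0); lra.
have t4 : t * (1 - t) * a ^+ 2 <= 4^-1 * a ^+ 2.
  rewrite ler_wpM2r ?sqr_ge0 //; have := sqr_ge0 (t - 2^-1); lra.
have D2 : D ^+ 2 <= (a / 2) ^+ 2 by rewrite ler_pXn2r ?nnegrE //; lra.
have ar : a ^+ 2 <= a * r by rewrite expr2 ler_wpM2l.
rewrite -(ler_pM2l r0); lra.
Qed.

End NearestPoint.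
(** [F] is [pi] followed by a sample point within [eps]. Points within [2 * mu] of [P] lie in the
    tube where [pi] is 3-Lipschitz, with [r = 3 * mu]; so [alpha / 6] becomes [alpha / 2], and the
    two errors [eps] add at most [alpha / 2]. On a half edge the three terms are [eps], the distance
    to [M] and the distance to [u], at most [alpha / 4], [alpha / 4] and [alpha / 2]. *)
Lemma sample_projection (M : set E) (P : {fset E}) eps alpha mu :
    compact M -> M !=set0 ->
    is_sample (fun x y => (eucl_dist x y)%:E) M eps P ->
    4 * eps <= alpha -> 0 < alpha <= mu -> ((3 * mu)%:E < reach M)%E ->
  exists F : E -> E,
    [/\ forall x, F x \in P,
        {in P, forall p, F p = p},
        forall x y u v, u \in P -> v \in P ->
          enorm (x - u) <= 2 * mu -> enorm (y - v) <= 2 * mu ->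
          6 * enorm (x - y) <= alpha -> enorm (F x - F y) <= alpha &
        forall u v t, u \in P -> v \in P -> enorm (v - u) <= alpha ->
          0 <= t <= 2^-1 -> enorm (F (u + t *: (v - u)) - u) <= alpha].
Proof.
move=> cM M0 [PM sampleP] eps_alpha /andP[a0 amu] mu_reach.
have [rho rho_reach mu_rho] : exists2 rho, (rho%:E <= reach M)%E & 3 * mu < rho.
  move: mu_reach; case: (reach M) => [rho| |] //.
  - by rewrite lte_fin; exists rho.
  - by exists (3 * mu + 1); rewrite ?leey // ltrDl.
have [pi piP] := choice (fun x => exists_nearest x cM M0).
have piM x : M (pi x) by case: (piP x).
have pi_min x y : M y -> enorm (x - pi x) <= enorm (x - y).
  by move=> My; have [_] := piP x; rewrite -!eucl_distE; apply.
have pi_unique x y : enorm (x - pi x) < rho -> M y ->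
    enorm (x - y) <= enorm (x - pi x) -> y = pi x.
  move=> dx My yx; apply/esym/(reach_unique_nearest rho_reach (piP x)).
    split=> // z Mz; rewrite eucl_distE (le_trans yx) // eucl_distE; exact: pi_min.
  by rewrite eucl_distE.
have PsubM p : p \in P -> M p by move=> pP; exact: PM.
have pi_id x : M x -> pi x = x.
  move=> Mx; apply/esym/eqP; rewrite -subr_eq0; apply/eqP/enorm_eq0/le_anti.
  by rewrite enorm_ge0 andbT -[0]enorm0 -(subrr x) pi_min.
have [x0 Mx0] := M0.
have eps0 : 0 <= eps.
  by have [p _] := sampleP x0 Mx0; rewrite lee_fin; apply: le_trans; exact: eucl_dist_ge0.
(* Off [M] the value is an arbitrary sample point; [s] is only evaluated at points [pi x]. *)
have exs x : exists p, [/\ p \in P, M x -> enorm (x - p) <= eps & x \in P -> p = x].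
  have [xP|xP] := boolP (x \in P).
    by exists x; split=> // _; rewrite subrr enorm0.
  have [Mx|nMx] := pselect (M x).
    by have [p pP] := sampleP x Mx; rewrite lee_fin eucl_distE; exists p.
  by have [p pP _] := sampleP x0 Mx0; exists p.
have [s sP] := choice exs.
have s_near x : enorm (pi x - s (pi x)) <= eps by have [_ + _] := sP (pi x); apply.
have tube x u : u \in P -> enorm (x - u) <= 2 * mu -> 3 * enorm (x - pi x) <= 2 * (3 * mu).
  by move=> /PsubM Mu xu; have := pi_min x u Mu; lra.
have mu0 : 0 < 3 * mu < rho by rewrite mu_rho andbT; lra.
exists (fun x => s (pi x)); split=> [x|p pP|x y u v uP vP xu yv xy|u v t uP vP uv t01].
- by have [] := sP (pi x).
- by rewrite (pi_id _ (PsubM _ pP)); have [_ _ ->] := sP p.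
- have := nearest_lipschitz cM piM pi_min pi_unique (tube _ _ uP xu) (tube _ _ vP yv) mu0.
  have := s_near x; have := s_near y.
  have -> : s (pi x) - s (pi y) = - (pi x - s (pi x)) + (pi x - pi y) + (pi y - s (pi y)).
    by rewrite opprB !addrA !subrK.
  have := enormD (- (pi x - s (pi x)) + (pi x - pi y)) (pi y - s (pi y)).
  have := enormD (- (pi x - s (pi x))) (pi x - pi y).
  by rewrite enormN; lra.
- have uv3 : enorm (v - u) <= 3 * mu by lra.
  have := dist_segment cM piM pi_min pi_unique (PsubM _ uP) (PsubM _ vP) uv3 mu0 t01.
  set x := u + _; have xu : enorm (x - u) <= enorm (v - u) / 2.
    have /andP[t0 t1] := t01.
    by rewrite /x addrC addKr enormZ ger0_norm // mulrC ler_wpM2l ?enorm_ge0.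
  have := s_near x.
  have -> : s (pi x) - u = - (pi x - s (pi x)) + (- (x - pi x) + (x - u)).
    by apply/rowP => i; rewrite !mxE; ring.
  have := enormD (- (pi x - s (pi x))) (- (x - pi x) + (x - u)).
  have := enormD (- (x - pi x)) (x - u).
  by rewrite !enormN; lra.
Qed.
End Euclid.

(** * Cones in the Rips complex *)

Section Rips.
Variables (R : realType) (n : nat).
Local Notation E := 'rV[R]_n.
Implicit Types (P Q : {fset E}) (x y p q : E).

Lemma rips3 alpha P a b c : 0 <= alpha -> a \in P -> b \in P -> c \in P ->
  enorm (a - b) <= alpha -> enorm (b - c) <= alpha -> enorm (a - c) <= alpha ->
  [fset a; b; c] \in rips_complex alpha P.
Proof.
move=> a0 aP bP cP ab bc ac; apply/ripsP; split.
- by rewrite !fsubUset !fsub1set aP bP cP.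
- by apply/fset0Pn; exists a; rewrite !inE eqxx.
have sym x y : enorm (x - y) <= alpha -> enorm (y - x) <= alpha by rewrite -enormN opprB.
move=> p q; rewrite !inE eucl_distE => /orP[/orP[]|] /eqP -> /orP[/orP[]|] /eqP ->;
  rewrite ?subrr ?enorm0 //; exact: sym.
Qed.

Lemma rips2 alpha P a b : 0 <= alpha -> a \in P -> b \in P ->
  enorm (a - b) <= alpha -> [fset a; b] \in rips_complex alpha P.
Proof.
move=> a0 aP bP ab; have := @rips3 alpha P b a a a0 bP aP aP.
rewrite -fsetUA fsetUid fsetUC subrr enorm0; apply=> //; by rewrite -enormN opprB.
Qed.

Lemma rips2P alpha P a b : [fset a; b] \in rips_complex alpha P ->
  [/\ a \in P, b \in P & enorm (a - b) <= alpha].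
Proof.
case/ripsP; rewrite fsubUset !fsub1set => /andP[aP bP] _ ab; split=> //.
by rewrite -eucl_distE ab ?fset21 ?fset22.
Qed.

Section Cone.
Variables (P : {fset E}) (alpha mu : R) (F : E -> E).
Hypothesis alpha_mu : 0 < alpha <= mu.
Hypothesis FP : forall x, F x \in P.
Hypothesis F_id : {in P, forall p, F p = p}.
Hypothesis F_near : forall x y u v, u \in P -> v \in P ->
  enorm (x - u) <= 2 * mu -> enorm (y - v) <= 2 * mu ->
  6 * enorm (x - y) <= alpha -> enorm (F x - F y) <= alpha.
Hypothesis F_half : forall u v t, u \in P -> v \in P -> enorm (v - u) <= alpha ->
  0 <= t <= 2^-1 -> enorm (F (u + t *: (v - u)) - u) <= alpha.
Local Notation K := (rips_complex alpha P).

Let alpha0 : 0 <= alpha.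
Proof. by case/andP: alpha_mu => /ltW. Qed.

(** * The cone over a single edge *)

Section ConePoint.
Variables (c u v : E).
Hypotheses (cP : c \in P) (uP : u \in P) (vP : v \in P).
Hypotheses (uv : enorm (v - u) <= alpha) (uc : enorm (u - c) <= 3 * mu)
  (vc : enorm (v - c) <= 3 * mu).

(** The affine cone over the segment from [u] to [v], with apex [c] at [s = 0] and base at
    [s = 1]. *)
Let X s t : E := c + s *: (u + t *: (v - u) - c).

Let base t : 0 <= t <= 1 -> enorm (u + t *: (v - u) - c) <= 3 * mu.
Proof.
move=> /andP[t0 t1].
have -> : u + t *: (v - u) - c = (1 - t) *: (u - c) + t *: (v - c).
  by apply/rowP => i; rewrite !mxE; ring.
apply: le_trans (enormD _ _) _; rewrite !enormZ !ger0_norm ?subr_ge0 //.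
have : (1 - t) * enorm (u - c) <= (1 - t) * (3 * mu) by apply: ler_wpM2l => //; lra.
have : t * enorm (v - c) <= t * (3 * mu) by apply: ler_wpM2l.
lra.
Qed.

(** For [s <= 2/3] the apex is within [2/3 * (3 * mu)]. Beyond that, [u] is near: at most [mu] to
    the base and at most [mu] along it. *)
Let tube s t : 0 <= s <= 1 -> 0 <= t <= 1 ->
  exists2 w, w \in P & enorm (X s t - w) <= 2 * mu.
Proof.
move=> /andP[s0 s1] t01; have bt := base t01; have /andP[a0 am] := alpha_mu.
have [t0 t1] := andP t01.
have [s23|s23] := lerP s (2 / 3).
  exists c => //; rewrite /X addrC addKr enormZ ger0_norm //.
  have : s * enorm (u + t *: (v - u) - c) <= 2 / 3 * (3 * mu).
    by apply: ler_pM; rewrite ?enorm_ge0.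
  lra.
exists u => //.
have -> : X s t - u = (- (1 - s)) *: (u + t *: (v - u) - c) + t *: (v - u).
  by rewrite /X; apply/rowP => i; rewrite !mxE; ring.
apply: le_trans (enormD _ _) _; rewrite !enormZ normrN !ger0_norm ?subr_ge0 //.
have : (1 - s) * enorm (u + t *: (v - u) - c) <= 1 / 3 * (3 * mu).
  by apply: ler_pM; rewrite ?enorm_ge0 //; lra.
have : t * enorm (v - u) <= 1 * mu by apply: ler_pM; rewrite ?enorm_ge0 // (le_trans uv).
lra.
Qed.

(** Changes of [s] and [t] by [e] move [X] by at most [3 * mu * e + mu * e]; the factor 6 in
    [F_near] turns this into [24 * mu * e]. *)
Let close s t s' t' e : 0 <= s <= 1 -> 0 <= t <= 1 -> 0 <= s' <= 1 -> 0 <= t' <= 1 ->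
  24 * mu * e <= alpha -> `|s - s'| <= e -> `|t - t'| <= e ->
  enorm (F (X s t) - F (X s' t')) <= alpha.
Proof.
move=> s01 t01 s01' t01' ea ss tt; have [w wP xw] := tube s01 t01.
have [w' wP' xw'] := tube s01' t01'.
apply: F_near wP wP' xw xw' _.
have -> : X s t - X s' t' = (s - s') *: (u + t *: (v - u) - c) + (s' * (t - t')) *: (v - u).
  by rewrite /X; apply/rowP => i; rewrite !mxE; ring.
have /andP[a0 am] := alpha_mu; have /andP[s0' s1'] := s01'.
have := enormD ((s - s') *: (u + t *: (v - u) - c)) ((s' * (t - t')) *: (v - u)).
rewrite !enormZ normrM (ger0_norm s0').
have : `|s - s'| * enorm (u + t *: (v - u) - c) <= e * (3 * mu).
  by apply: ler_pM; rewrite ?enorm_ge0 ?normr_ge0 // base.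
have : s' * `|t - t'| <= 1 * e by apply: ler_pM; rewrite ?normr_ge0.
have e0 : 0 <= e by apply: le_trans ss; rewrite normr_ge0.
rewrite mul1r => h; have : s' * `|t - t'| * enorm (v - u) <= e * mu.
  by apply: ler_pM; rewrite ?enorm_ge0 ?mulr_ge0 ?normr_ge0 // (le_trans uv).
lra.
Qed.

(** [F] carries a fine grid on the cone into [K]. The essential point is that the side [k u] depends
    on [u] and [c] but not on [v]. The number of steps is even so that the midpoint of the base is a
    node. *)
Lemma cone_edge N : (0 < N)%N -> 24 * mu <= alpha * N%:R ->
  let k u := seq_chain K (fun i => F (c + (i%:R / N.*2%:R) *: (u - c))) N.*2 in
  homologous (edge K u v) (k u + k v).
Proof.
move=> N0 Nbig /=; pose M := N.*2; pose q i : R := i%:R / M%:R.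
have M0 : 0 < M%:R :> R by rewrite ltr0n double_gt0.
have MN : M%:R = 2 * N%:R :> R by rewrite /M -mul2n natrM.
have N0' : 0 < N%:R :> R by rewrite ltr0n.
have q01 i : (i <= M)%N -> 0 <= q i <= 1.
  move=> iM; rewrite divr_ge0 ?ler0n //= ler_pdivrMr // mul1r ler_nat //.
have qS i : `|q i.+1 - q i| = M%:R^-1.
  by rewrite /q -mulrBl -natrB // subSnn mul1r ger0_norm // invr_ge0 ltW.
have e1 : 24 * mu * M%:R^-1 <= alpha.
  rewrite ler_pdivrMr // MN; have := alpha0.
  have : 0 <= alpha * N%:R by rewrite mulr_ge0 // ltW.
  lra.
have e0 : (0:R) <= M%:R^-1 by rewrite invr_ge0 ltW.
have X1 t : X 1 t = u + t *: (v - u) by rewrite /X scale1r [LHS]addrC subrK.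
pose G i j := F (X (q i) (q j)).
have grid : homologous (seq_chain K (G^~ 0%N) M + seq_chain K (G^~ M) M)
    (seq_chain K (G 0%N) M + seq_chain K (G M) M).
  apply: grid_boundary => i j iM jM.
  have qi := q01 _ (ltnW iM); have qj := q01 _ (ltnW jM).
  have qi1 := q01 _ iM; have qj1 := q01 _ jM.
  split; apply: rips3; rewrite /G ?FP //; apply: (close _ _ _ _ e1) => //;
    by rewrite ?subrr ?normr0 // distrC qS.
(* This side of the grid is constant, equal to [F c]. *)
have GO : seq_chain K (G 0%N) M = 0.
  rewrite /seq_chain big1 // => i _; rewrite /G /X /q !mul0r !scale0r addr0.
  by rewrite edge_id.
have q0 : q 0%N = 0 by rewrite /q mul0r.
have qM : q M = 1 by rewrite /q divff // gt_eqF.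
have kuE : (G^~ 0%N) = (fun i => F (c + q i *: (u - c))).
  by apply: funext => i; rewrite /G /X q0 scale0r addr0.
have kvE : (G^~ M) = (fun i => F (c + q i *: (v - c))).
  by apply: funext => i; rewrite /G /X qM scale1r [u + _]addrC subrK.
have GE : G M = (fun i => F (u + q i *: (v - u))).
  by apply: funext => i; rewrite /G qM X1.
rewrite GO add0r kuE kvE GE in grid.
apply: homologous_sym; apply: homologous_trans grid _.
set s := fun i => _.
have sP i : s i \in P by rewrite /s FP.
have step i : (i < M)%N -> enorm (s i - s i.+1) <= alpha.
  move=> iM; have -> : s i = F (X 1 (q i)) by rewrite X1.
  have -> : s i.+1 = F (X 1 (q i.+1)) by rewrite X1.
  apply: (close _ _ _ _ e1); rewrite ?ler01 ?lexx //; try exact: q01.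
  - exact/q01/ltnW.
  - by rewrite subrr normr0.
  - by rewrite distrC qS.
have qN : q N = 2^-1 by rewrite /q MN; field; rewrite gt_eqF.
(* It remains to compare the subdivided base with the edge. [F_half] reaches only the midpoint, so
   the first half is filled by a fan from [u], the second by a fan from [v], and the triangle on
   [u], [s N], [v] closes the gap. *)
have near_u i : (i <= N)%N -> enorm (s i - u) <= alpha.
  move=> iN; apply: F_half => //; rewrite -qN.
  have /andP[-> _] /= : 0 <= q i <= 1.
    by apply: q01; rewrite /M -addnn (leq_trans iN) // leq_addr.
  by rewrite ler_wpM2r // ler_nat.
have near_v i : (i <= N)%N -> enorm (s (N + i)%N - v) <= alpha.
  move=> iN; have -> : s (N + i)%N = F (v + (1 - q (N + i)%N) *: (u - v)).
    by congr F; apply/rowP => j; rewrite !mxE; ring.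
  apply: F_half => //; first by rewrite -enormN opprB.
  have /andP[_ h] : 0 <= q (N + i)%N <= 1 by apply: q01; rewrite /M -addnn leq_add2l.
  rewrite subr_ge0 h /=; have : q N <= q (N + i)%N by rewrite ler_wpM2r // ler_nat leq_addr.
  rewrite qN; lra.
have s0 : s 0%N = u by rewrite /s q0 scale0r addr0 F_id.
have sM : s (N + N)%N = v by rewrite /s addnn qM scale1r [u + _]addrC subrK F_id.
have -> : seq_chain K s M = seq_chain K s N + seq_chain K (fun i => s (N + i)%N) N.
  rewrite /seq_chain /M -addnn big_split_ord /=.
  by congr (_ + _); apply: eq_bigr => i _; rewrite addnS.
have cu : homologous (seq_chain K s N) (edge K u u + edge K u (s N)).
  rewrite -{2}s0; apply: cone_boundary => i iN; apply: rips3 => //.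
  - by rewrite -enormN opprB near_u // ltnW.
  - by rewrite step // /M -addnn (leq_trans iN) // leq_addr.
  - by rewrite -enormN opprB near_u.
have cv : homologous (seq_chain K (fun i => s (N + i)%N) N) (edge K v (s N) + edge K v v).
  have := @cone_boundary _ K v (fun i => s (N + i)%N) N.
  rewrite /= sM addn0; apply => i iN.
  apply: rips3 => //.
  - by rewrite -enormN opprB near_v // ltnW.
  - by rewrite addnS step // /M -addnn ltn_add2l.
  - by rewrite -enormN opprB near_v.
apply: homologous_trans (homologousD cu cv) _; rewrite !edge_id add0r addr0.
have : [fset u; s N; v] \in K.
  apply: rips3 => //.
  - by rewrite -enormN opprB near_u.
  - by rewrite -(addn0 N) near_v.
  - by rewrite -enormN opprB.
by move/triangle_boundary; rewrite (edgeC _ (s N)).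
Qed.
End ConePoint.

(** A single [k] serves all edges near [c], because the mesh depends on [alpha] and [mu] only. Along
    any walk near [c] the right sides telescope, so closed walks bound. *)
Lemma exists_cone c : c \in P -> exists k : E -> chain K 1,
  forall u v, u \in P -> v \in P -> enorm (u - v) <= alpha ->
    enorm (u - c) <= 3 * mu -> enorm (v - c) <= 3 * mu ->
    homologous (edge K u v) (k u + k v).
Proof.
move=> cP; have /andP[a0 am] := alpha_mu.
pose N := Num.bound (24 * mu / alpha).
have Nbig : 24 * mu <= alpha * N.+1%:R.
  have mu_a : 0 <= 24 * mu / alpha by rewrite divr_ge0 // mulr_ge0 //; lra.
  rewrite [leRHS]mulrC -ler_pdivrMr //; apply: ltW; apply: (lt_le_trans (archi_boundP mu_a)).
  by rewrite ler_nat.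
pose k (u : E) : chain K 1 :=
  seq_chain K (fun i => F (c + (i%:R / N.+1.*2%:R) *: (u - c))) N.+1.*2.
exists k; move=> u v uP vP uv uc vc; apply: cone_edge => //.
by rewrite -enormN opprB.
Qed.
End Cone.
End Rips.

(** * Walks and fibers of the nearest point map *)

Section WalkChains.
Variable T : choiceType.
Implicit Types (K L : {fset {fset T}}) (w : seq T).

Fixpoint walk_chain K p w : chain K 1 :=
  if w is x :: w' then edge K p x + walk_chain K x w' else 0.

Lemma bd_walk_chain K p w : path (fun x y => [fset x; y] \in K) p w ->
  bd K 0 (walk_chain K p w) = vertex K p + vertex K (last p w).
Proof.
elim: w p => [|x w IHw] p /=; first by rewrite linear0 addcc.
by move=> /andP[px /IHw e]; rewrite linearD /= bd_edge // e addcKK.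
Qed.

Lemma push_walk_chain (f : T -> T) K L p w : simplicial_map f K L ->
  path (fun x y => ([fset x; y] \in K) && (f x == f y)) p w ->
  push f K L 1 (walk_chain K p w) = 0.
Proof.
move=> fKL; elim: w p => [|x w IHw] p /=; first by rewrite linear0.
move=> /andP[/andP[px /eqP fpx] /IHw e].
by rewrite linearD /= push_edge // e fpx edge_id addr0.
Qed.

Lemma homologous_walk_chain K (k : T -> chain K 1) (r : rel T) p w :
  (forall x y, x \in p :: w -> y \in p :: w -> r x y ->
     homologous (edge K x y) (k x + k y)) ->
  path r p w -> homologous (walk_chain K p w) (k p + k (last p w)).
Proof.
elim: w p => [|x w IHw] p h /=; first by rewrite addcc homologous_refl.
move=> /andP[px xw]; rewrite -(addcKK (k p) (k x)); apply: homologousD.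
  by apply: h; rewrite ?inE ?eqxx ?orbT.
by apply: IHw xw => y z yw zw; apply: h; rewrite inE ?yw ?zw orbT.
Qed.
End WalkChains.

(** * Shortest walks in the graph *)

Section Walks.
Variables (R : realType) (n : nat) (alpha : R) (P : {fset 'rV[R]_n}).
Local Notation E := 'rV[R]_n.
Implicit Types (p q x y : E) (w : seq E).
Local Notation gd := (graph_dist alpha P).

Lemma walk_length_cons p x w :
  walk_length p (x :: w) = eucl_dist p x + walk_length x w.
Proof. by rewrite /walk_length /= big_cons. Qed.

Lemma walk_length_ge0 p w : 0 <= walk_length p w.
Proof. by apply: sumr_ge0 => e _; exact: eucl_dist_ge0. Qed.

Lemma walk_length_through p w x : x \in p :: w ->
  eucl_dist p x + eucl_dist x (last p w) <= walk_length p w.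
Proof.
elim: w p x => [|y w IHw] p x.
  by rewrite inE => /eqP ->; rewrite /walk_length /= big_nil eucl_distxx addr0.
rewrite inE walk_length_cons /= => /orP[/eqP ->|/IHw xw].
  have := IHw y y (mem_head y w); rewrite !eucl_distxx.
  have := eucl_dist_triangle y p (last y w); lra.
have := eucl_dist_triangle y p x; lra.
Qed.

Lemma graph_dist_ge0 p q : (0 <= gd p q)%E.
Proof.
by apply/ereal_infP => _ [w _ <-]; rewrite lee_fin walk_length_ge0.
Qed.

Lemma graph_dist_step p x q : p \in P -> graph_edge alpha p x ->
  (gd p q <= (eucl_dist p x)%:E + gd x q)%E.
Proof.
move=> pP px; rewrite -leeBlDl //; apply/ereal_infP => _ [w [xw wP wq] <-].
rewrite leeBlDl // -EFinD -walk_length_cons; apply: ereal_inf_lbound.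
exists (x :: w) => //; split => //=; first by rewrite px.
by move=> y; rewrite inE => /orP[/eqP ->|/wP].
Qed.

(** There may be infinitely many walks, but only finitely many first steps, since [P] is finite. If
    every first step overshot, so would their minimum [m], which bounds the length of every walk
    from below. *)
Lemma graph_dist_attained p q : p != q -> (gd p q < +oo)%E ->
  exists x, [/\ p \in P, x \in P, graph_edge alpha p x &
    (eucl_dist p x)%:E + gd x q <= gd p q]%E.
Proof.
move=> pq pqfin; apply: contrapT => none.
have [pP|pP] := boolP (p \in P); last first.
  suff : (gd p q = +oo)%E by move=> e; rewrite e in pqfin.
  apply/eqP; rewrite -leye_eq; apply/ereal_infP => _ [w [_ wP _] <-].
  by have := wP p (mem_head _ _); rewrite (negPf pP).
pose m := \big[Order.min/+oo%E]_(x <- P | graph_edge alpha p x) ((eucl_dist p x)%:E + gd x q)%E.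
have : (gd p q < m)%E.
  rewrite /m big_seq_cond; apply: lt_bigmin => // x /andP[xP px].
  by rewrite ltNge; apply/negP => h; apply: none; exists x.
rewrite ltNge => /negP; apply; apply/ereal_infP => _ [[|x w] [pw wP wq] <-].
  by rewrite /= in wq; rewrite wq eqxx in pq.
move: pw => /= /andP[px xw]; have xP : x \in P by apply: wP; rewrite !inE eqxx orbT.
rewrite walk_length_cons EFinD.
apply: (@le_trans _ _ ((eucl_dist p x)%:E + gd x q)%E).
  exact: bigmin_inf_seq xP px (le_refl _).
apply: leeD2l; apply: ereal_inf_lbound; exists w => //; split=> //.
by move=> y yw; apply: wP; rewrite inE yw orbT.
Qed.

Variables (Q : {fset E}) (prio : E -> nat) (nu : E -> E).
Hypothesis prio_inj : {in Q &, injective prio}.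
Hypothesis nuP : nearest_point_map gd P Q prio nu.

(* The tie-breaking rule makes the fibers of [nu] closed under shortest paths
   to the nearest point. *)
Lemma nearest_along_shortest p x : p \in P -> x \in P -> graph_edge alpha p x ->
  (gd p (nu p) < +oo)%E ->
  ((eucl_dist p x)%:E + gd x (nu p) <= gd p (nu p))%E -> nu x = nu p.
Proof.
move=> pP xP px pfin shortest.
have [npQ pmin pprio] := nuP pP; have [nxQ xmin xprio] := nuP xP.
have le_x q : q \in Q -> (gd x (nu p) <= gd x q)%E.
  move=> qQ; rewrite -(leeD2lE (x := (eucl_dist p x)%:E)) //.
  exact: le_trans shortest (le_trans (pmin q qQ) (graph_dist_step q pP px)).
have exq : gd x (nu p) = gd x (nu x) by apply/le_anti; rewrite le_x // xmin.
have epq : gd p (nu x) = gd p (nu p).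
  apply/le_anti; rewrite pmin // andbT.
  by apply: le_trans (graph_dist_step _ pP px) _; rewrite -exq.
by apply: prio_inj => //; apply/eqP; rewrite eqn_leq xprio // pprio.
Qed.

(** First steps of shortest paths stay in the fiber and bring the walk strictly closer to [nu p];
    the induction counts the points of [P] that are closer still. *)
Lemma exists_fiber_walk p : p \in P -> (gd p (nu p) < +oo)%E ->
  exists w, [/\ graph_walk alpha P p (nu p) w,
    {in p :: w, forall x, nu x = nu p} &
    ((walk_length p w)%:E <= gd p (nu p))%E].
Proof.
have [k] := ubnP #|` [fset y in P | (gd y (nu p) < gd p (nu p))%E]|.
elim: k p => // k IHk p pk pP pfin; have [pq|pq] := eqVneq p (nu p).
  exists [::]; split.
  - by split=> // x; rewrite inE => /eqP ->.
  - by move=> x; rewrite inE => /eqP ->.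
  - by rewrite /walk_length big_nil graph_dist_ge0.
have [x [_ xP px shortest]] := graph_dist_attained pq pfin.
have nux := nearest_along_shortest pP xP px pfin shortest.
have xlt : (gd x (nu p) < gd p (nu p))%E.
  apply: (lt_le_trans _ shortest).
  have xfin : gd x (nu p) \is a fin_num.
    rewrite ge0_fin_numE ?graph_dist_ge0 //; apply: le_lt_trans pfin.
    by apply: (le_trans _ shortest); rewrite leeDr // lee_fin eucl_dist_ge0.
  rewrite -(fineK xfin) -EFinD lte_fin ltrDr lt_def eucl_dist_ge0 andbT.
  by case/andP: px => + _; apply: contra_neq => /eucl_dist_eq0.
have [| |w [[xw wP wq] wnu wlen]] := IHk x _ xP.
- rewrite nux; move: pk; rewrite ltnS; apply: leq_trans; apply: fproper_ltn_card.
  rewrite fproperEneq; apply/andP; split.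
    apply/eqP => /fsetP /(_ x); rewrite !inE xP xlt /= ltxx //.
  by apply/fsubsetP => y; rewrite !inE /= => /andP[-> /lt_trans -> //].
- by rewrite nux (lt_trans xlt).
exists (x :: w); split.
- split=> /=; [by rewrite px| |by rewrite wq].
  by move=> y; rewrite inE => /orP[/eqP ->|/wP].
- by move=> y; rewrite inE => /orP[/eqP ->//|/wnu ->].
- rewrite walk_length_cons EFinD; apply: (le_trans _ shortest).
  by rewrite leeD2l // -nux.
Qed.
End Walks.

(** Without edges there are no nonzero 1-chains, so both homology groups are trivial. *)
Lemma no_edges_isomorphism (T : choiceType) (f : T -> T) (K L : {fset {fset T}}) :
  simplicial_complex K -> simplicial_map f K L ->
  (forall A, A \in K -> #|` A| != 2%N) -> (forall A, A \in L -> #|` A| != 2%N) ->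
  zmod_isomorphism (homology_map f K L 1).
Proof.
move=> cK fKL K2 L2.
have chain0 (M : {fset {fset T}}) (z : chain M 1) :
    (forall A, A \in M -> #|` A| != 2%N) -> z = 0.
  by move=> M2; apply/ffunP => s; have [sM s2] := simplicesP s; have := M2 _ sM; rewrite s2.
apply: homology_map_isomorphism => // z _.
  by move=> _; rewrite (chain0 K z K2) mem0v.
by exists 0; rewrite ?mem0v // linear0 (chain0 L z L2).
Qed.

(** Holds because [3 / 5 < 1]. It is applied to the larger of [alpha] and [delta], which becomes
    [mu]. *)
Lemma lt_reach (R : realType) (a : R) (r : \bar R) : 0 < a ->
  (a%:E <= (3^-1 * Num.sqrt (3 / 5))%:E * r)%E -> ((3 * a)%:E < r)%E.
Proof.
move=> a0; set k := Num.sqrt (3 / 5) : R.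
have k0 : 0 < k by rewrite sqrtr_gt0 divr_gt0.
have k1 : k < 1.
  rewrite -(@ltr_pXn2r _ 2) ?nnegrE ?ler01 ?(ltW k0) // sqr_sqrtr; last by rewrite divr_ge0.
  by rewrite expr1n; lra.
have k3 : 0 < 3^-1 * k by rewrite mulr_gt0.
case: r => [r| |]; rewrite ?ltry //.
  rewrite -EFinM !lee_fin lte_fin => ar.
  have r0 : 0 < r by rewrite -(pmulr_rgt0 _ k3) (lt_le_trans a0).
  have : k * r < 1 * r by rewrite ltr_pM2r.
  lra.
by rewrite gt0_muleNy // lte_fin.
Qed.

(** * The isomorphism for positive [alpha] *)

Section Main.
Variables (R : realType) (n : nat) (alpha delta mu : R).
Local Notation E := 'rV[R]_n.
Variables (M : set E) (P Q : {fset E}) (eps : R) (prio : E -> nat) (nu : E -> E).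
Hypothesis cM : compact M.
Hypothesis P_sample : is_sample (fun x y => (eucl_dist x y)%:E) M eps P.
Hypothesis QP : Q `<=` P.
Hypothesis Q_sample : is_sample (graph_dist alpha P) [set` P] delta Q.
Hypothesis eps_alpha : 4 * eps <= alpha.
Hypothesis alpha_mu : 0 < alpha <= mu.
Hypothesis delta_mu : delta <= mu.
Hypothesis mu_reach : ((3 * mu)%:E < reach M)%E.
Hypothesis prio_inj : {in Q &, injective prio}.
Hypothesis nuP : nearest_point_map (graph_dist alpha P) P Q prio nu.

Local Notation K := (rips_complex alpha P).
Local Notation L := (graph_induced_complex alpha P Q nu).

Let nuQ : {in P, forall p, nu p \in Q}.
Proof. by move=> p /nuP[]. Qed.

Let dist_nu p : p \in P -> (graph_dist alpha P p (nu p) <= delta%:E)%E.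
Proof.
move=> pP; have [_ /(_ p pP)[q qQ pq]] := Q_sample.
by have [_ /(_ q qQ) pmin _] := nuP pP; exact: le_trans pq.
Qed.

Let fiber_walk p : exists w, p \in P ->
  [/\ graph_walk alpha P p (nu p) w, {in p :: w, forall x, nu x = nu p} &
      walk_length p w <= delta].
Proof.
have [pP|] := boolP (p \in P); last by exists [::].
have [|w [pw wnu wlen]] := exists_fiber_walk prio_inj nuP pP.
  by rewrite (le_lt_trans (dist_nu pP)) ?ltry.
by exists w => _; split=> //; rewrite -lee_fin (le_trans wlen) ?dist_nu.
Qed.

(** The criterion [fiber_criterion] applies with [gamma p] a walk of length at most [delta] from [p]
    to [nu p] inside the fiber, which [nu] contracts to a point. *)
Lemma nearest_point_isomorphism : zmod_isomorphism (homology_map nu K L 1).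
Proof.
have /andP[a0 amu] := alpha_mu.
have fKL : simplicial_map nu K L := simplicial_map_gic (alpha := alpha) nuQ.
have cK := rips_complexP alpha P; have cL := graph_induced_complexP alpha P Q nu.
have [w wP] := choice fiber_walk.
pose gamma p := if p \in P then walk_chain K p (w p) else 0.
have edgeK x y : x \in P -> y \in P -> graph_edge alpha x y -> [fset x; y] \in K.
  by move=> xP yP /andP[_ xy]; apply: rips2; rewrite ?(ltW a0) // -eucl_distE.
apply: (@fiber_criterion _ nu K L gamma) => //.
- move=> A; rewrite !inE /= => /and3P[_ A0 /existsP[s /and3P[cs sA /eqP nuA]]].
  exists (val s); last by split=> //; exact/eqP.
  have /andP[sP /forallP sedge] := cs.
  apply/ripsP; split=> //; first by rewrite -cardfs_eq0 (eqP sA) cardfs_eq0.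
  move=> p q ps qs; have [->|pq] := eqVneq p q; first by rewrite eucl_distxx ltW.
  have /forallP/(_ [` qs]) /= := sedge [` ps].
  by rewrite -val_eqE /= pq => /andP[].
- move=> p /ripsP[]; rewrite fsub1set => pP _ _; rewrite /gamma pP.
  have [[pw pwP wlast] _ _] := wP p pP; rewrite -wlast bd_walk_chain //.
  apply: (sub_in_path (P := mem (p :: w p)) _ _ pw); last exact/allP.
  by move=> x y /pwP xP /pwP yP; exact: edgeK.
- move=> p; rewrite /gamma; case: ifP => pP; last by rewrite linear0.
  have [[pw pwP _] wnu _] := wP p pP; apply: push_walk_chain => //.
  apply: (sub_in_path (P := mem (p :: w p)) _ _ pw); last exact/allP.
  by move=> x y xw yw xy; rewrite edgeK ?pwP //= !wnu.
move=> a b a' b' abK abK' aa' bb'.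
have [aP bP ab] := rips2P abK; have [aP' bP' ab'] := rips2P abK'.
have M0 : M !=set0 by exists a; exact: P_sample.1.
have [F [FP F_id F_near F_half]] :=
  sample_projection cM M0 P_sample eps_alpha alpha_mu mu_reach.
(* The common center [nu a] of the fibers of [a] and [a'] is the apex for both hooks. *)
have cP : nu a \in P by apply: (fsubsetP QP); exact: nuQ.
have [k kP] := exists_cone alpha_mu FP F_id F_near F_half cP.
have far p x : p \in P -> x \in p :: w p -> eucl_dist p x + eucl_dist x (nu p) <= mu.
  move=> pP xw; have [[_ _ <-] _ wlen] := wP p pP.
  exact: le_trans (walk_length_through xw) (le_trans wlen delta_mu).
have hook p q : p \in P -> q \in P -> enorm (p - q) <= alpha -> nu p = nu a ->
    homologous (edge K p q + (gamma p + gamma q)) (k (nu p) + k (nu q)).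
  move=> pP qP pq pa.
  have near_p x : x \in p :: w p -> enorm (x - nu a) <= 3 * mu.
    move=> /(far _ _ pP); rewrite -pa -eucl_distE; have := eucl_dist_ge0 p x; lra.
  have near_q x : x \in q :: w q -> enorm (x - nu a) <= 3 * mu.
    (* From [x] to [q], from [q] to [p] and from [p] to [nu p] are at most [mu] each; this is the
       source of the radius [3 * mu]. *)
    move=> /(far _ _ qP); rewrite -pa -eucl_distE.
    have := far _ _ pP (mem_head p _); rewrite eucl_distxx => ppa.
    have := eucl_dist_triangle q x (nu p); have := eucl_dist_triangle p q (nu p).
    rewrite -eucl_distE in pq; rewrite (eucl_distC q p) (eucl_distC x q).
    have := eucl_dist_ge0 x (nu q); lra.
  have hom_gamma r : r \in P -> (forall x, x \in r :: w r -> enorm (x - nu a) <= 3 * mu) ->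
      homologous (gamma r) (k r + k (nu r)).
    move=> rP near_r; rewrite /gamma rP; have [[rw rwP wlast] _ _] := wP r rP.
    rewrite -wlast; apply: homologous_walk_chain rw => x y xw yw /andP[_ xy].
    by rewrite eucl_distE in xy; apply: kP; rewrite ?rwP ?near_r.
  have := homologousD (kP p q pP qP pq (near_p _ (mem_head _ _)) (near_q _ (mem_head _ _)))
    (homologousD (hom_gamma p pP near_p) (hom_gamma q qP near_q)).
  by rewrite (addrACA (k p)) (addrA (k p)) (addrA (k q)) !addcc !add0r.
apply: homologous_trans (hook a b aP bP ab erefl) _; rewrite aa' bb'.
exact/homologous_sym/hook/esym.
Qed.
End Main.

Theorem theorem4p2 (R : realType) (n m : nat) (M : set 'rV[R]_n)
    (P Q : {fset 'rV[R]_n}) (eps alpha delta : R)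
    (prio : 'rV[R]_n -> nat) (nu : 'rV[R]_n -> 'rV[R]_n)
    (M_manifold : embedded_smooth_manifold m M)
    (M_compact : compact M)
    (P_sample : is_sample (fun x y => (eucl_dist x y)%:E) M eps P)
    (QP : (Q `<=` P)%fset)
    (Q_sample : is_sample (graph_dist alpha P) [set` P] delta Q)
    (alpha_ge : 4 * eps <= alpha)
    (alpha_le : (alpha%:E <= (3^-1 * Num.sqrt (3 / 5))%:E * reach M)%E)
    (delta_ge : 4 * eps <= delta)
    (delta_le : (delta%:E <= (3^-1 * Num.sqrt (3 / 5))%:E * reach M)%E)
    (prio_inj : {in Q &, injective prio})
    (nu_nearest : nearest_point_map (graph_dist alpha P) P Q prio nu) :
  zmod_isomorphism
    (homology_map nu (rips_complex alpha P)
       (graph_induced_complex alpha P Q nu) 1).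
Proof.
have [a0|a0] := lerP alpha 0; last first.
  apply: (@nearest_point_isomorphism _ _ alpha delta (Num.max alpha delta)
    M P Q eps prio) => //.
  - by rewrite a0 le_max lexx.
  - by rewrite le_max lexx orbT.
  - apply: lt_reach; first by rewrite lt_max a0.
    by rewrite EFin_max ge_max alpha_le.
(* For [alpha <= 0] distinct points are never adjacent, so neither complex has an edge. *)
have no_pair (p q : 'rV[R]_n) : graph_edge alpha p q = false.
  apply/negP => /andP[/eqP pq dpq]; apply: pq; apply: eucl_dist_eq0.
  by apply: le_anti; rewrite eucl_dist_ge0 (le_trans dpq).
have clique_small s : clique alpha P s -> (#|` s| <= 1)%N.
  move=> cs; rewrite leqNgt; apply/negP => s2.
  have [p ps] : exists p, p \in s by apply/fset0Pn; rewrite -cardfs_gt0 ltnW.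
  have [q] : exists q, q \in s `\ p.
    by apply/fset0Pn; rewrite -cardfs_gt0; move: s2; rewrite (cardfsD1 p) ps.
  rewrite !inE => /andP[qp qs].
  have /andP[_ /forallP sedge] := cs.
  have /forallP/(_ [` qs]) /= := sedge [` ps].
  by rewrite no_pair -val_eqE /= eq_sym qp.
apply: no_edges_isomorphism => [||A|A].
- exact: rips_complexP.
- by apply: simplicial_map_gic => p /nu_nearest[].
- by move=> /cliqueE/clique_small; case: #|` A| => [|[]].
- rewrite !inE /= => /and3P[_ _ /existsP[s /and3P[/clique_small s1 /eqP <- _]]].
  by move: s1; case: #|` _| => [|[]].
Qed.
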